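(* Let $d,r$ be integers with $1\le d<q$ and $1\le r\le\binom{m+d}{d}-r_d$. Then there is an integer $e_0$ such that for all $e\ge e_0$ and all $\mathcal{S}\subseteq\overline{\mathbb{M}}_d$ with $|\mathcal{S}|=r$, $$|\Delta_e(\mathcal{S})|\le|\Delta_e(\mathcal{M}_d(r))|.$$ Consequently, $A_r(d,m;e)=|\Delta_e(\mathcal{M}_d(r))|$ and $\overline{e}_r(d,m)\le|\Delta_e(\mathcal{M}_d(r))|$ for all sufficiently large $e$.
   Context: Let $q$ be a prime power, $\mathbb{F}_q$ the finite field with $q$ elements, $m$ a positive integer. A monomial $\mu\neq 1$ in $x_0,\dots,x_m$ can be written $\mu=x_0^{a_0}\cdots x_\ell^{a_\ell}$ with $0\le\ell\le m$, $a_\ell>0$; it is projectively reduced if $a_0,\dots,a_{\ell-1}\le q-1$; $1$ is also projectively reduced. A polynomial is projectively reduced if it is an $\mathbb{F}_q$-linear combination of projectively reduced monomials. $\overline{\mathbb{M}}_e$ denotes the set of projectively reduced monomials of degree $e$. $r_d$ is the $\mathbb{F}_q$-dimension of the degree-$d$ homogeneous component of the ideal of $\mathbb{F}_q[x_0,\dots,x_m]$ generated by $\{x_i^qx_j-x_ix_j^q:0\le i<j\le m\}$ (one has $|\overline{\mathbb{M}}_d|=\binom{m+d}{d}-r_d$, and $r_d=0$ for $d\le q$). For a set $\mathcal{S}$ of monomials, $\nabla_e(\mathcal{S})=\{\mu\in\overline{\mathbb{M}}_e:\nu\mid\mu\text{ for some }\nu\in\mathcal{S}\}$ and $\Delta_e(\mathcal{S})=\overline{\mathbb{M}}_e\setminus\nabla_e(\mathcal{S})$.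 $A_r(d,m;e)=\max\{|\Delta_e(\mathcal{S})|:\mathcal{S}\subseteq\overline{\mathbb{M}}_d,|\mathcal{S}|=r\}$. Lexicographic order: $x_0^{b_0}\cdots x_m^{b_m}\prec x_0^{a_0}\cdots x_m^{a_m}$ iff at the first index where exponents differ, $a_i>b_i$. $\mathcal{M}_d(r)$ is the set of the first $r$ elements of $\overline{\mathbb{M}}_d$ in descending lexicographic order. $\overline{e}_r(d,m)$ is the maximum of the number of points of $\mathbb{P}^m(\mathbb{F}_q)$ at which $G_1,\dots,G_r$ all vanish, over all families of $r$ linearly independent projectively reduced homogeneous polynomials $G_1,\dots,G_r$ of degree $d$ in $\mathbb{F}_q[x_0,\dots,x_m]$. *)

(* Defs.v *)
From mathcomp Require Import all_boot all_order all_algebra all_field.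
From mathcomp Require Import mpoly.
Set Implicit Arguments. Unset Strict Implicit. Unset Printing Implicit Defensive.
Import GRing.Theory.

(* Monomials x_0^{a_0} ... x_m^{a_m} in m+1 variables are represented by their
   exponent vectors.  For sets of monomials of degree e we use the finite type
   of exponent vectors with entries <= e.                                    *)
Definition mono (m e : nat) := {ffun 'I_m.+1 -> 'I_e.+1}.

Definition mdegree (m e : nat) (a : mono m e) : nat := \sum_(i < m.+1) (a i : nat).

(* projectively reduced exponent vector: with l the last index having a
   positive exponent, a_0, ..., a_{l-1} <= q - 1  (the zero vector, i.e. the
   monomial 1, is reduced).                                                  *)
Definition proj_reduced (q m : nat) (a : 'I_m.+1 -> nat) : bool :=
  [forall i : 'I_m.+1, forall j : 'I_m.+1,
     ((i < j)%N && (0 < a j)%N) ==> (a i <= q - 1)%N].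

Definition Mbar (q m e : nat) : {set mono m e} :=
  [set a : mono m e | (mdegree a == e) && proj_reduced q (fun i => (a i : nat))].

Definition mdivides (m d e : nat) (nu : mono m d) (mu : mono m e) : bool :=
  [forall i : 'I_m.+1, (nu i : nat) <= (mu i : nat)].

Definition nabla (q m d e : nat) (S : {set mono m d}) : {set mono m e} :=
  [set mu in Mbar q m e | [exists nu in S, mdivides nu mu]].

Definition Delta (q m d e : nat) (S : {set mono m d}) : {set mono m e} :=
  Mbar q m e :\: nabla q e S.

Definition lexlt (m : nat) (b a : 'I_m.+1 -> nat) : bool :=
  [exists i : 'I_m.+1,
    [forall j : 'I_m.+1, (j < i)%N ==> (b j == a j)] && (b i < a i)%N].

(* M_d(r): the first r elements of \overline{M}_d in descending lex order,
   i.e. those elements having fewer than r elements of \overline{M}_d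
   lexicographically above them. *)
Definition Mfirst (q m d r : nat) : {set mono m d} :=
  [set a in Mbar q m d |
     (#|[set b in Mbar q m d | lexlt (fun i => (a i : nat)) (fun i => (b i : nat)) ]| < r)%N].

Definition A_r (q m d e r : nat) : nat :=
  \max_(S : {set mono m d} | (S \subset Mbar q m d) && (#|S| == r))
     #|Delta q e S|.

Definition homog_deg (F : fieldType) (n d : nat) (p : {mpoly F[n]}) : bool :=
  all (fun mm : 'X_{1..n} => mdeg mm == d) (msupp p).

Definition poly_proj_reduced (F : fieldType) (q m : nat) (p : {mpoly F[m.+1]}) : bool :=
  all (fun mm : 'X_{1..m.+1} => proj_reduced q (fun i => mm i)) (msupp p).

Definition lin_indep (F : fieldType) (n r : nat) (G : 'I_r -> {mpoly F[n]}) : Prop :=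
  forall c : 'I_r -> F, (\sum_(i < r) c i *: G i = 0)%R -> forall i, c i = 0%R.

(* Points of P^m(F): canonical representatives, i.e. vectors whose first
   nonzero coordinate equals 1. *)
Definition proj_point (F : finFieldType) (m : nat) (x : {ffun 'I_m.+1 -> F}) : bool :=
  [exists i : 'I_m.+1, (x i == 1%R) && [forall j : 'I_m.+1, (j < i)%N ==> (x j == 0%R)]].

Definition num_common_zeros (F : finFieldType) (m r : nat)
    (G : 'I_r -> {mpoly F[m.+1]}) : nat :=
  #|[set x : {ffun 'I_m.+1 -> F} | proj_point x &&
       [forall i : 'I_r, (G i).@[x] == 0%R]]|.

(* Main.v *)
Require Import Defs.
From mathcomp Require Import all_boot all_order all_algebra all_field.
From mathcomp Require Import mpoly zify.
Set Implicit Arguments. Unset Strict Implicit. Unset Printing Implicit Defensive.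

(** For [e] large, a reduced monomial of degree [e] is determined by the index
    [l] of its last variable and by exponents [a_0, ..., a_(l-1) < q], hence
    corresponds to a point of the projective space.  The number of these points
    lying above [S] is shown to be minimal for lexicographic segments, by
    induction on the number of variables; inside the induction the exponent of
    [x_0] is bounded by some [p <= q] with [d < p].  Slice [S] by the exponent
    of [x_0].  Three operations do not increase the number of points above [S]:
    replacing every slice by the lexicographic segment of the same size
    (segments generate nested sets of points); compressing in the two variables
    [x_0, x_1], the others being fixed; and, once [S] is stable under these,
    moving elements from the slice [x_0^0] to the first incomplete slice.  The
    last two increase the total exponent of [x_0] in [S], so that the process ends,
    either with a segment or with a set all of whose elements are divisible by
    [x_0], which is treated by induction on [d].

    The bound on common zeros is the projective footprint bound: a linear
    functional supported on the common zeros that kills the monomials outside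
    the ideal of the leading monomials kills all monomials of degree [e], by
    induction along the lexicographic order, whereas forms of degree [e]
    separate points. *)

(** * Block laws *)

Lemma big_nat_const_eq (a b c : nat) (G : nat -> nat) :
  (forall i, a <= i < b -> G i = c) -> \sum_(a <= i < b) G i = (b - a) * c.
Proof. by move=> h; rewrite (eq_big_nat _ _ h) sum_nat_const_nat. Qed.

Definition psum (nu : nat -> nat) (k : nat) : nat := \sum_(0 <= i < k) nu i.

Lemma psum0 (nu : nat -> nat) : psum nu 0 = 0.
Proof. by rewrite /psum big_nil. Qed.

Lemma psumS (nu : nat -> nat) (k : nat) : psum nu k.+1 = psum nu k + nu k.
Proof. by rewrite /psum big_nat_recr. Qed.

Lemma psum_mono (nu : nat -> nat) (a b : nat) : a <= b -> psum nu a <= psum nu b.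
Proof.
elim: b => [|b IH]; first by rewrite leqn0 => /eqP->.
rewrite leq_eqVlt ltnS => /orP[/eqP->//|/IH h].
by rewrite psumS (leq_trans h) ?leq_addr.
Qed.

(* [f k] is meant as the partial sum function of a list of [nu k] weights of
   total [w]: the numbers of points gained when the lexicographic segment of
   degree [k] grows.  Writing a monomial as [x_0^i v] concatenates these lists
   ([block_law_step]), so the laws propagate to any number of variables. *)
Record block_law (q w : nat) (nu : nat -> nat) (f : nat -> nat -> nat) : Prop :=
  BlockLaw {
    bl_zero : forall k, k < q -> f k 0 = 0;
    bl_mono : forall k s t, k < q -> s <= t -> f k s <= f k t;
    bl_full : forall k t, k < q -> nu k <= t -> f k t = w;
    bl_nu0 : nu 0 = 1;
    bl_nu : forall k, k.+1 < q -> nu k <= nu k.+1;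
    bl_deg : forall k t, k.+1 < q -> f k.+1 t <= f k t;
    bl_sub : forall k y h, k < q -> f k (y + h) <= f k y + f k h;
    bl_win : forall k L b, k < q -> L <= b -> b <= nu k ->
      f k (b - L) + w <= f k b + f k (nu k - L);
    bl_suf : forall k L, k.+1 < q -> L <= nu k ->
      f k (nu k - L) <= f k.+1 (nu k.+1 - L)
  }.

Section BlockStep.
Variables (q w : nat) (nu : nat -> nat) (f : nat -> nat -> nat).
Hypothesis bl : block_law q w nu f.
Hypothesis q_gt0 : 0 < q.
Let cc := psum nu.

(** Summing over all degrees below [q] makes [B] and [E] independent of the degree of the segment:
    by [gEE], a nonempty segment of degree [k] has value [E r] up to the constant [(q - k) * w]. The
    laws for [g] thus become inequalities for the single function [E]. *)
Let B (r : nat) : nat := \sum_(1 <= k < q) f k (r - cc k).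
Let E (r : nat) : nat := (0 < r) + B r.

Let cc1 : cc 1 = 1.
Proof. by rewrite /cc /psum big_nat1 (bl_nu0 bl). Qed.

Let ccS k : cc k.+1 = cc k + nu k. Proof. exact: psumS. Qed.

Let cc_mono a b : a <= b -> cc a <= cc b. Proof. exact: psum_mono. Qed.

Let f_le k t : k < q -> f k t <= w.
Proof.
move=> kq; rewrite -(bl_full bl kq (leq_maxr t (nu k))).
by apply: (bl_mono bl) => //; rewrite leq_maxl.
Qed.

Let B_mono s t : s <= t -> B s <= B t.
Proof.
move=> st; rewrite /B big_nat [X in _ <= X]big_nat.
apply: leq_sum => k /andP[_ kq]; apply: (bl_mono bl) => //; exact: leq_sub2r.
Qed.

Let E_mono s t : s <= t -> E s <= E t.
Proof. by move=> st; rewrite /E; have := B_mono st; lia. Qed.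

Let B_split k t : 0 < k < q -> t <= nu k -> B (cc k + t) = k.-1 * w + f k t.
Proof.
move=> /andP[k0 kq] tk; rewrite /B.
rewrite (big_cat_nat (n := k)) //=; last exact: ltnW.
rewrite (@big_nat_const_eq 1 k w) ?subn1; last first.
  move=> i /andP[i0 ik]; apply: (bl_full bl); first exact: ltn_trans ik kq.
  by have := @cc_mono i.+1 k ik; rewrite ccS; lia.
congr (_ + _); rewrite big_ltn //.
rewrite addKn (@big_nat_const_eq k.+1 q 0) ?muln0 ?addn0 //.
move=> i /andP[ki iq]; have -> : cc k + t - cc i = 0.
  by have := @cc_mono k.+1 i ki; rewrite ccS; lia.
exact: (bl_zero bl).
Qed.

Let B0 : B 0 = 0.
Proof.
by rewrite /B (@big_nat_const_eq _ _ 0) ?muln0 // => i /andP[_ iq]; rewrite sub0n (bl_zero bl).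
Qed.

Let B_full k : k < q -> B (cc k.+1) = k * w.
Proof.
case: k => [|k] kq.
  rewrite cc1 /B mul0n (@big_nat_const_eq _ _ 0) ?muln0 // => i /andP[i0 iq].
  have -> : 1 - cc i = 0 by have := @cc_mono 1 i i0; rewrite cc1; lia.
  exact: (bl_zero bl).
by rewrite ccS B_split // (bl_full bl) //= mulSn addnC.
Qed.

Let B_le r : B r <= q.-1 * w.
Proof.
rewrite /B -subn1 -sum_nat_const_nat big_nat [X in _ <= X]big_nat.
by apply: leq_sum => k /andP[_ kq]; exact: f_le.
Qed.

Let cc_pos k : 0 < k -> 0 < cc k.
Proof. by move=> k0; have := @cc_mono 1 k k0; rewrite cc1. Qed.

Let E_full k : k < q -> E (cc k.+1) = 1 + k * w.
Proof. by move=> kq; rewrite /E B_full // cc_pos. Qed.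

Let E_split k t : k.+1 < q -> t <= nu k.+1 -> E (cc k.+1 + t) = 1 + k * w + f k.+1 t.
Proof.
move=> kq tk; rewrite /E B_split //=.
by rewrite addn_gt0 cc_pos //= addnA.
Qed.

(** Block [i.+1] on the left is compared with block [i] on the right: [f] decreases with the degree,
    and since block lengths increase, no more of block [i.+1] is reached than of block [i]. *)
Let B_shift a y : a.+1 < q -> B (cc a.+2 + y) <= w + B (cc a.+1 + y).
Proof.
move=> aq; rewrite /B.
rewrite (big_cat_nat (n := a.+2)) //=.
rewrite (@big_nat_const_eq 1 a.+2 w); last first.
  move=> i /andP[i0 ik]; apply: (bl_full bl); first lia.
  by have := @cc_mono i.+1 a.+2 ik; rewrite ccS; lia.
rewrite [X in _ <= w + X](big_cat_nat (n := a.+1)) //=; last lia.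
rewrite (@big_nat_const_eq 1 a.+1 w); last first.
  move=> i /andP[i0 ik]; apply: (bl_full bl); first lia.
  by have := @cc_mono i.+1 a.+1 ik; rewrite ccS; lia.
rewrite !subSS !subn0 mulSn -addnA leq_add2l leq_add2l.
rewrite big_add1.
apply: (@leq_trans (\sum_(a.+1 <= i < q.-1) f i (cc a.+1 + y - cc i))); last first.
  rewrite [X in _ <= X](big_cat_nat (n := q.-1)) /=; [exact: leq_addr|lia|lia].
rewrite big_nat [X in _ <= X]big_nat; apply: leq_sum => i /andP[ai iq].
have iq' : i.+1 < q by lia.
apply: leq_trans (bl_deg bl _ iq') _; apply: (bl_mono bl); first lia.
suff : cc a.+2 + cc i <= cc i.+1 + cc a.+1 by lia.
have : nu a.+1 <= nu i.
  elim: i ai iq iq' => // i IH; rewrite leq_eqVlt => /orP[/eqP<-//|ai] iq iq'.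
  apply: leq_trans (IH _ _ _) _; try lia; apply: (bl_nu bl); lia.
by rewrite !ccS; lia.
Qed.

Let B_window a y : a < q -> B (cc a.+1 + y) <= a * w + B (1 + y).
Proof.
elim: a => [|a IH] aq; first by rewrite cc1.
by have := B_shift y aq; have := IH (ltnW aq); rewrite mulSn; lia.
Qed.

Let locate s : 0 < s -> s < cc q -> exists2 k, 0 < k < q & cc k <= s < cc k.+1.
Proof.
move=> s0; elim: q => [|k IH]; first by rewrite /cc /psum big_nil.
move=> sk; case: (ltnP s (cc k)) => h.
  by case: (IH h) => j jk js; exists j => //; lia.
exists k; last by rewrite h.
by case: k {IH} sk h => [|k] sk h; [move: sk; rewrite cc1; lia|lia].
Qed.

(** Rounding [s] up to the end [cc k.+1] of its block costs at most one [w]; by [B_window] the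
    remaining elements count no more than the same number taken from the first block on. *)
Let B_subadd s t : 0 < s -> 0 < t -> B (s + t) <= B s + B t + w.
Proof.
move=> s0 t0; case: (ltnP s (cc q)) => h; last first.
  apply: leq_trans (B_le _) _; rewrite -B_full; last lia.
  rewrite prednK // -addnA; apply: leq_trans (B_mono h) _; exact: leq_addr.
have [k /andP[k0 kq] /andP[ks sk]] := locate s0 h.
have Bs : k.-1 * w <= B s.
  by rewrite -B_full ?prednK //; [exact: B_mono|lia].
have kw : k * w = k.-1 * w + w by rewrite -{1}(prednK k0) mulSn addnC.
case: (leqP (s + t) (cc k.+1)) => st.
  by have := B_mono st; rewrite B_full //; lia.
have -> : s + t = cc k.+1 + (s + t - cc k.+1) by lia.
have := @B_window k (s + t - cc k.+1) kq.
have : B (1 + (s + t - cc k.+1)) <= B t by apply: B_mono; lia.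
lia.
Qed.

(** In terms of weights: the last [L] weights up to the end of block [k.+1] total at most the last
    [L] weights up to the end of block [k]. *)
Let E_suf k L : k.+1 < q -> L < cc k.+1 -> w + E (cc k.+1 - L) <= E (cc k.+2 - L).
Proof.
elim: k L => [|k IH] L kq Lc.
  have -> : L = 0 by move: Lc; rewrite cc1; lia.
  by rewrite !subn0 !E_full //; lia.
have nuk := bl_nu bl kq.
case: (leqP L (nu k.+1)) => h.
  have -> : cc k.+2 - L = cc k.+1 + (nu k.+1 - L) by rewrite (ccS k.+1); lia.
  have -> : cc k.+3 - L = cc k.+2 + (nu k.+2 - L) by rewrite (ccS k.+2); lia.
  rewrite !E_split //; try lia.
  have := bl_suf bl kq h; lia.
have e1 : cc k.+2 - L = cc k.+1 - (L - nu k.+1) by rewrite (ccS k.+1); lia.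
have Lc' : L - nu k.+1 < cc k.+1 by move: Lc; rewrite (ccS k.+1); lia.
have ih := IH _ (ltnW kq) Lc'; rewrite e1; apply: leq_trans ih _.
by apply: E_mono; rewrite (ccS k.+2); lia.
Qed.

(* The last [L] weights of a block are the lightest among [L] consecutive ones. *)
Let E_win k L b : k < q -> L < b -> b <= cc k.+1 ->
  E (b - L) + E (cc k.+1) <= E b + E (cc k.+1 - L).
Proof.
elim: k L b => [|k IH] L b kq Lb bc.
  have [-> ->] : L = 0 /\ b = 1 by move: bc; rewrite cc1; lia.
  by rewrite cc1; lia.
have Ek : E (cc k.+2) = E (cc k.+1) + w by rewrite !E_full //; lia.
case: (leqP b (cc k.+1)) => bk.
  have := IH L b (ltnW kq) Lb bk; have := @E_suf k L kq; lia.
have Ek' := E_full (ltnW kq).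
set h := b - cc k.+1; have eb : b = cc k.+1 + h by rewrite /h; lia.
have hn : h <= nu k.+1 by move: bc; rewrite (ccS k.+1); lia.
have Eb : E b = 1 + k * w + f k.+1 h by rewrite eb E_split.
case: (leqP L h) => Lh.
  have -> : b - L = cc k.+1 + (h - L) by lia.
  have -> : cc k.+2 - L = cc k.+1 + (nu k.+1 - L) by rewrite (ccS k.+1); lia.
  rewrite Eb Ek Ek' !E_split //; try lia.
  have := bl_win bl kq Lh hn; lia.
(* From here on the window straddles the boundary [cc k.+1], with [h] of its weights in the last
   block. *)
have eL : b - L = cc k.+1 - (L - h) by lia.
case: (leqP L (nu k.+1)) => Ln.
  have s : L - h < cc k.+1 by lia.
  have := E_suf kq s.
  have -> : cc k.+2 - (L - h) = cc k.+1 + (nu k.+1 - (L - h)) by rewrite (ccS k.+1); lia.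
  have -> : cc k.+2 - L = cc k.+1 + (nu k.+1 - L) by rewrite (ccS k.+1); lia.
  rewrite eL Eb Ek Ek' !E_split //; try lia.
  have := bl_sub bl (nu k.+1 - L) h kq.
  have -> : nu k.+1 - L + h = nu k.+1 - (L - h) by lia.
  lia.
have e2 : cc k.+2 - L = cc k.+1 - (L - nu k.+1) by rewrite (ccS k.+1); lia.
have z1 : nu k.+1 - h < cc k.+1 - (L - nu k.+1) by lia.
have := IH _ _ (ltnW kq) z1 (leq_subr _ _).
have -> : cc k.+1 - (L - nu k.+1) - (nu k.+1 - h) = cc k.+1 - (L - h) by lia.
have z2 : nu k.+1 - h < cc k.+1 by lia.
have := E_suf kq z2.
have -> : cc k.+2 - (nu k.+1 - h) = cc k.+1 + h by rewrite (ccS k.+1); lia.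
rewrite E_split // eL Eb Ek Ek' e2; lia.
Qed.

Variable g : nat -> nat -> nat.
Hypothesis gE : forall k r, k < q ->
  g k r = (0 < r) * (1 + (q - k) * w) + \sum_(1 <= j < k.+1) f j (r - cc j).

Let gB k r : k < q -> r <= cc k.+1 -> g k r = (0 < r) * (1 + (q - k) * w) + B r.
Proof.
move=> kq rk; rewrite gE //; congr (_ + _); rewrite /B.
rewrite [RHS](big_cat_nat (n := k.+1)) //=.
rewrite [X in _ = _ + X](@big_nat_const_eq _ _ 0) ?muln0 ?addn0 //.
move=> i /andP[ki iq]; have -> : r - cc i = 0.
  by have := @cc_mono k.+1 i ki; lia.
exact: (bl_zero bl).
Qed.

Let gEE k r : k < q -> 0 < r -> r <= cc k.+1 -> g k r = (q - k) * w + E r.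
Proof. by move=> kq r0 rk; rewrite gB // /E r0; lia. Qed.

Let g0 k : k < q -> g k 0 = 0. Proof. by move=> kq; rewrite gB // B0. Qed.

Let g_mono k s t : k < q -> s <= t -> g k s <= g k t.
Proof.
move=> kq st; rewrite !gE //; apply: leq_add; first by rewrite leq_mul2r; lia.
rewrite big_nat [X in _ <= X]big_nat.
apply: leq_sum => i /andP[_ ik]; apply: (bl_mono bl); first lia.
exact: leq_sub2r.
Qed.

Let g_full k t : k < q -> cc k.+1 <= t -> g k t = 1 + q * w.
Proof.
move=> kq kt; rewrite gE //.
have -> : 0 < t by have := @cc_pos k.+1; lia.
rewrite (@big_nat_const_eq _ _ w).
  by rewrite subn1 mul1n -addnA -mulnDl; congr (_ + _ * _) => /=; lia.
move=> i /andP[i0 ik]; apply: (bl_full bl); first lia.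
by have := @cc_mono i.+1 k.+1 ik; rewrite ccS; lia.
Qed.

Let g_sub k y h : k < q -> g k (y + h) <= g k y + g k h.
Proof.
move=> kq.
have main y' h' : y' + h' <= cc k.+1 -> g k (y' + h') <= g k y' + g k h'.
  case: y' => [|y'] c; first by rewrite add0n leq_addl.
  case: h' c => [|h'] c; first by rewrite addn0 leq_addr.
  rewrite !gB //; try lia.
  have := @B_subadd y'.+1 h'.+1 isT isT.
  have : w <= (q - k) * w by rewrite leq_pmull; lia.
  rewrite addn_gt0 /= !mul1n; lia.
case: (leqP (y + h) (cc k.+1)) => c; first exact: main.
case: (leqP (cc k.+1) y) => cy.
  by rewrite (g_full kq (ltnW c)) (g_full kq cy) leq_addr.
have -> : g k (y + h) = g k (y + (cc k.+1 - y)).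
  by rewrite !g_full //; lia.
apply: leq_trans (main _ _ _) _; first lia.
by rewrite leq_add2l; apply: g_mono => //; lia.
Qed.

Lemma block_law_step : block_law q (1 + q * w) (fun k => cc k.+1) g.
Proof.
split=> //.
- by move=> k kq; apply: cc_mono.
- move=> k t kq; rewrite !gE //; last lia.
  rewrite [X in _ + X <= _]big_nat_recr //= addnA addnAC leq_add2r.
  case: t => [|t]; first by rewrite sub0n (bl_zero bl).
  rewrite !mul1n; have := @f_le k.+1 (t.+1 - cc k.+1) kq.
  have -> : (q - k) * w = (q - k.+1) * w + w by rewrite -mulSnr; congr (_ * _); lia.
  lia.
(* For [L = b] the window law is subadditivity of [g]. *)
- move=> k L b kq Lb /= bk; case: (ltngtP L b) Lb => // [Lb|eLb] _; last first.
    rewrite -eLb in bk *.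
    rewrite subnn g0 // add0n -(g_full kq (leqnn _)).
    have -> : cc k.+1 = L + (cc k.+1 - L) by lia.
    by rewrite addKn; exact: g_sub.
  have := E_win kq Lb bk; rewrite -(g_full kq (leqnn _)).
  rewrite !gEE //; lia.
- move=> k L kq /=; rewrite leq_eqVlt => /orP[/eqP->|Lk].
    by rewrite subnn g0 //; lia.
  have kc := @cc_mono k.+1 k.+2 (leqnSn _).
  by have := E_suf kq Lk; rewrite !gEE //; lia.
Qed.

(* Concentrating mass in the row of smaller degree is favourable as long as
   the row of larger degree is the shorter one. *)
Lemma block_exchange k d s b x : k < d -> d < q -> 0 < b -> b <= s -> s < cc k.+1 ->
  x = minn b (cc k.+1 - s) -> g d (b - x) + g k (s + x) <= g d b + g k s.
Proof.
move=> kd dq b0 bs sk ex.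
have kq : k < q by exact: ltn_trans dq.
have cd := @cc_mono k.+1 d.+1 (ltnW kd).
case: (leqP b (cc k.+1 - s)) => h.
  have -> : x = b by lia.
  rewrite subnn g0 // !gB //; try lia.
  have := @B_subadd s b; have : w <= (q - d) * w by rewrite leq_pmull; lia.
  have -> : 0 < s by lia.
  have -> : 0 < s + b by lia.
  rewrite b0; lia.
have -> : x = cc k.+1 - s by lia.
have Lb : cc k.+1 - s < b by lia.
have bk : b <= cc k.+1 by lia.
have := E_win kq Lb bk; rewrite !gEE; try lia.
have -> : cc k.+1 - (cc k.+1 - s) = s by lia.
have -> : s + (cc k.+1 - s) = cc k.+1 by lia.
lia.
Qed.

End BlockStep.

(** * Compression in the plane *)

Definition antidiag (p q : nat) (U : nat -> nat -> bool) (T : nat) : seq nat :=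
  [seq i <- iota 0 p | [&& i <= T, T - i < q & U i (T - i)]].

Lemma mem_antidiag p q U T i :
  (i \in antidiag p q U T) = [&& i < p, i <= T, T - i < q & U i (T - i)].
Proof. by rewrite mem_filter mem_iota add0n leq0n andbC. Qed.

Lemma antidiag_uniq p q U T : uniq (antidiag p q U T).
Proof. by rewrite filter_uniq // iota_uniq. Qed.

Lemma sum_antidiag p q (U : nat -> nat -> bool) :
  \sum_(0 <= i < p) \sum_(0 <= b < q) U i b =
  \sum_(0 <= T < p + q) size (antidiag p q U T).
Proof.
rewrite [RHS](eq_bigr (fun T => \sum_(0 <= i < p) ([&& i <= T, T - i < q & U i (T - i)] : nat)));
  last first.
  move=> T _; rewrite /antidiag size_filter -sum1_count big_mkcond /= /index_iota subn0.
  by apply: eq_bigr => i _; case: ifP.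
rewrite [RHS]exchange_big /= big_nat [RHS]big_nat; apply: eq_bigr => i /andP[_ ip].
rewrite [RHS](big_cat_nat (n := i)) //=; last lia.
rewrite [X in _ = X + _]big_nat [X in _ = X + _]big1 ?add0n; last first.
  by move=> T /andP[_ Ti]; have -> : (i <= T) = false by lia.
rewrite [RHS](big_cat_nat (n := i + q)) //=; [|lia|lia].
rewrite [X in _ = _ + X]big_nat [X in _ = _ + X]big1 ?addn0; last first.
  move=> T /andP[qT _]; have -> : (T - i < q) = false by lia.
  by rewrite /= andbF.
rewrite -{2}[i]add0n big_addn addKn big_nat [RHS]big_nat.
by apply: eq_bigr => b /andP[_ bq]; rewrite leq_addl addnK bq.
Qed.

Section UpSet.
Variables (p q : nat) (U : nat -> nat -> bool).
Hypothesis pq : p <= q.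
Hypothesis upx : forall i b, U i b -> U i.+1 b.
Hypothesis upy : forall i b, U i b -> U i b.+1.
Let ad := antidiag p q U.
Let full := antidiag p q (fun _ _ => true).

(** The points of one antidiagonal inject into the next around the hole [g]: those left of it move
    right, the others move up. No move lands on the hole because [U] is an up-set, and none leaves
    the rectangle because the hole lies in it. *)
Lemma size_antidiag_missing T g : g < p -> g <= T.+1 -> T.+1 - g < q ->
  ~~ U g (T.+1 - g) -> size (ad T) <= size (ad T.+1).
Proof.
move=> gp gT gq Ug.
pose phi i := if i < g then i.+1 else i.
have ne i : i \in ad T -> i != g /\ i.+1 != g.
  rewrite mem_antidiag => /and4P[ip iT iq Ui]; split; apply/eqP => e.
    by move: Ug; rewrite -e subSn // upy.
  by move: Ug; rewrite -e subSS upx.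
rewrite -(size_map phi); apply: uniq_leq_size.
  rewrite map_inj_in_uniq ?antidiag_uniq // => i j /ne[/eqP i1 /eqP i2] /ne[/eqP j1 /eqP j2].
  by rewrite /phi; case: (ltnP i g) => ?; case: (ltnP j g) => ? ?; lia.
move=> x /mapP[i ii ->]; have [/eqP i1 /eqP i2] := ne _ ii.
move: ii; rewrite !mem_antidiag /phi => /and4P[ip iT iq Ui].
case: (ltnP i g) => ig; first by rewrite subSS upx // andbT; lia.
by rewrite subSn // upy // andbT; lia.
Qed.

(** All points move up and the rightmost one also moves right, which yields one more point. *)
Lemma size_antidiag_grow T : T.+1 < p -> 0 < size (ad T) ->
  size (ad T) < size (ad T.+1).
Proof.
move=> Tp s0.
have ex : exists i, i \in ad T.
  by case: (ad T) s0 => // x s _; exists x; rewrite inE eqxx.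
have bd i : i \in ad T -> i <= p by rewrite mem_antidiag; lia.
case: (ex_maxnP ex bd) => j jT jmax.
rewrite -[_.+1]/(size (j.+1 :: ad T)); apply: uniq_leq_size.
  rewrite /= antidiag_uniq andbT; apply/negP => /jmax; lia.
move=> x; rewrite inE => /orP[/eqP->|].
  move: jT; rewrite !mem_antidiag subSS => /and4P[jp jT jq Uj].
  by rewrite upx // andbT; lia.
rewrite !mem_antidiag => /and4P[jp jT' jq Uj].
by rewrite subSn // upy // andbT; lia.
Qed.

Lemma size_antidiag_low s t T : 0 < s -> s <= size (ad t) -> t <= T -> T < p ->
  s + (T - t) <= size (ad T).
Proof.
move=> s0 st; elim: T => [|T IH].
  by rewrite leqn0 => /eqP t0 _; rewrite sub0n addn0 -t0.
rewrite leq_eqVlt => /orP[/eqP<- _|tT Tp]; first by rewrite subnn addn0.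
have h := IH tT (ltnW Tp).
have := @size_antidiag_grow T Tp; lia.
Qed.

(** Past the width [p] an antidiagonal is either full, or has a hole and is then at least as large
    as the previous one. *)
Lemma size_antidiag_high s t T : 0 < s -> s <= size (ad t) -> t < p -> p.-1 <= T ->
  minn (s + (p.-1 - t)) (size (full T)) <= size (ad T).
Proof.
move=> s0 st tp; elim: T => [|T IH].
  move=> p0; rewrite geq_min; apply/orP; left.
  have := @size_antidiag_low s t 0 s0 st; lia.
rewrite leq_eqVlt => /orP[/eqP<-|pT].
  rewrite geq_min; apply/orP; left.
  by apply: size_antidiag_low => //; lia.
case: (boolP (all (fun g => U g (T.+1 - g)) (full T.+1))) => [al|].
  rewrite geq_min; apply/orP; right.
  apply: uniq_leq_size; first exact: antidiag_uniq.
  move=> i ifull; have := allP al _ ifull; move: ifull; rewrite !mem_antidiag /=.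
  by rewrite andbT => /and3P[-> -> ->].
rewrite -has_predC => /hasP[g]; rewrite mem_antidiag /= => /and4P[gp gT gq _] Ug.
apply: leq_trans (size_antidiag_missing gp gT gq Ug).
apply: leq_trans (IH _); last lia.
have : size (full T.+1) <= size (full T).
  apply: uniq_leq_size; first exact: antidiag_uniq.
  by move=> i; rewrite !mem_antidiag; lia.
lia.
Qed.

End UpSet.

(* The up-set of the plane generated by the points [(t z - k, k)] with [P z k]. *)
Definition stair (Z : Type) (zs : seq Z) (t : Z -> nat) (P : Z -> pred nat)
    (i b : nat) : bool :=
  has (fun z => has (fun k => [&& P z k, t z - k <= i & k <= b]) (iota 0 (t z).+1)) zs.

(** The index [k] stands for the point [(t - k, k)], so small [k] means large first coordinate. *)
Definition initial_seg (t : nat) (P : pred nat) : pred nat :=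
  fun k => k < count P (iota 0 t.+1).

(** The comparison is made on each antidiagonal [T]. The least first coordinate [i0] of the
    compressed up-set comes from one family [z], say with [s] elements, which bounds the compressed
    count by [s + (T - t z)], or by the size of the full antidiagonal. The original up-set has at
    least [s] points on the antidiagonal [t z], and the growth lemmas provide as many on [T]. *)
Lemma stair_compression (Z : eqType) (zs : seq Z) (t : Z -> nat) (P : Z -> pred nat)
    (p q : nat) : p <= q -> (forall z, z \in zs -> t z < p) ->
  \sum_(0 <= i < p) \sum_(0 <= b < q) stair zs t (fun z => initial_seg (t z) (P z)) i b <=
  \sum_(0 <= i < p) \sum_(0 <= b < q) stair zs t P i b.
Proof.
move=> pq tp; set U' := stair zs t (fun z => _); set U := stair zs t P.
rewrite !sum_antidiag; apply: leq_sum => T _.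
have upx i b : U i b -> U i.+1 b.
  move=> /hasP[z zz /hasP[k kk /and3P[h1 h2 h3]]].
  by apply/hasP; exists z => //; apply/hasP; exists k => //; rewrite h1 h3 (leqW h2).
have upy i b : U i b -> U i b.+1.
  move=> /hasP[z zz /hasP[k kk /and3P[h1 h2 h3]]].
  by apply/hasP; exists z => //; apply/hasP; exists k => //; rewrite h1 h2 (leqW h3).
case: (posnP (size (antidiag p q U' T))) => [-> //|pos].
have ex : exists i, i \in antidiag p q U' T.
  by case: (antidiag p q U' T) pos => // x s _; exists x; rewrite inE eqxx.
case: (ex_minnP ex) => i0; rewrite mem_antidiag => /and4P[i0p i0T i0q].
move=> /hasP[z zz /hasP[k _ /and3P[kc ki kT]]] imin.
have tz := tp _ zz; rewrite /initial_seg in kc.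
set s := count _ _ in kc.
have s0 : 0 < s by exact: leq_ltn_trans kc.
have st : s <= size (antidiag p q U (t z)).
  rewrite /s -size_filter -(size_map (fun k => t z - k)); apply: uniq_leq_size.
    rewrite map_inj_in_uniq ?filter_uniq ?iota_uniq // => x y.
    by rewrite !mem_filter !mem_iota => /andP[_ h1] /andP[_ h2]; lia.
  move=> x /mapP[l]; rewrite mem_filter => /andP[Pl li] ->.
  move: (li); rewrite mem_iota => lt; rewrite mem_antidiag.
  apply/and4P; split; try lia.
  apply/hasP; exists z => //; apply/hasP; exists l => //; rewrite Pl; lia.
case: (ltnP T p) => Tp.
  have tT : t z <= T by lia.
  have := size_antidiag_low pq upx upy s0 st tT Tp; apply: leq_trans.
  apply: (@leq_trans (T.+1 - i0)); last lia.
  rewrite -(size_iota i0 (T.+1 - i0)); apply: uniq_leq_size.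
    exact: antidiag_uniq.
  by move=> x xx; have := imin _ xx; move: xx; rewrite mem_antidiag mem_iota; lia.
have pT : p.-1 <= T by lia.
have := size_antidiag_high pq upx upy s0 st tz pT; apply: leq_trans.
rewrite leq_min; apply/andP; split.
  apply: (@leq_trans (p - i0)); last lia.
  rewrite -(size_iota i0 (p - i0)); apply: uniq_leq_size; first exact: antidiag_uniq.
  by move=> x xx; have := imin _ xx; move: xx; rewrite mem_antidiag mem_iota; lia.
apply: uniq_leq_size; first exact: antidiag_uniq.
by move=> x; rewrite !mem_antidiag; lia.
Qed.

Lemma count_initial_seg t P : count (initial_seg t P) (iota 0 t.+1) = count P (iota 0 t.+1).
Proof.
rewrite /initial_seg.
have : count P (iota 0 t.+1) <= t.+1 by rewrite -[X in _ <= X](size_iota 0) count_size.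
move: (count P (iota 0 t.+1)) => s.
elim: t.+1 s => [|l IH] s sl; first by move: sl; rewrite leqn0 => /eqP->.
rewrite -addn1 iotaD count_cat /= add0n addn0.
have IH' := IH (minn s l) (geq_minr _ _).
have e : count (fun k => k < s) (iota 0 l) = minn s l.
  rewrite -[RHS]IH'; apply: eq_in_count => k; rewrite mem_iota => /andP[_ kl]; lia.
rewrite e; lia.
Qed.

(** The equality case serves termination: a compression that changes some fiber strictly lowers
    [weight]. *)
Lemma sum_initial_seg_leq t P :
  \sum_(0 <= k < t.+1) initial_seg t P k * k <= \sum_(0 <= k < t.+1) P k * k
  ?= iff [forall k : 'I_t.+1, P k == initial_seg t P k].
Proof.
have gen l : \sum_(0 <= k < l) (k < count P (iota 0 l)) * k <= \sum_(0 <= k < l) P k * k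
    /\ (\sum_(0 <= k < l) (k < count P (iota 0 l)) * k = \sum_(0 <= k < l) P k * k ->
        forall k, k < l -> P k = (k < count P (iota 0 l))).
  elim: l => [|l [IH1 IH2]]; first by rewrite !big_nil.
  have cl : count P (iota 0 l) <= l by rewrite -[X in _ <= X](size_iota 0) count_size.
  have cE : count P (iota 0 l.+1) = count P (iota 0 l) + P l.
    by rewrite -[l.+1]addn1 iotaD count_cat /= addn0.
  rewrite cE !big_nat_recr //.
  case Pl: (P l) => /=; last first.
    rewrite addn0 ltnNge cl !mul0n !addn0; split => // e k.
    rewrite ltnS leq_eqVlt => /orP[/eqP->|]; first by rewrite Pl; lia.
    exact: IH2.
  rewrite addn1.
  have E : \sum_(0 <= k < l) (k < (count P (iota 0 l)).+1) * k + (l < (count P (iota 0 l)).+1) * l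
     = \sum_(0 <= k < l) (k < count P (iota 0 l)) * k + count P (iota 0 l).
    (* Raising the bound from [c] to [c.+1] adds the single element [c] to the sum. *)
    have gg c m : c <= m -> \sum_(0 <= k < m) (k < c.+1) * k + (m < c.+1) * m =
        \sum_(0 <= k < m) (k < c) * k + c.
      elim: m => [|m IHm] cm; first by rewrite !big_nil; lia.
      rewrite !big_nat_recr //=; case: (leqP c m) => h.
        by have := IHm h; lia.
      have <- : m.+1 = c by lia.
      have -> : \sum_(0 <= i < m) (i < m.+2) * i = \sum_(0 <= i < m) (i < m.+1) * i.
        by rewrite big_nat [RHS]big_nat; apply: eq_bigr => i /andP[_ im]; congr (_ * _); lia.
      lia.
    exact: gg.
  rewrite E mul1n; split; first by apply: leq_add.
  move=> e k; have [e1 e2] : \sum_(0 <= k < l) (k < count P (iota 0 l)) * k =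
    \sum_(0 <= k < l) P k * k /\ count P (iota 0 l) = l by lia.
  rewrite ltnS leq_eqVlt => /orP[/eqP->|kl]; first by rewrite Pl; lia.
  by rewrite (IH2 e1) //; lia.
have [g1 g2] := gen t.+1; split=> //.
apply/eqP/forallP => [e k|h]; first by rewrite [P k](g2 e).
rewrite big_nat [RHS]big_nat; apply: eq_bigr => k /andP[_ kt].
by have /eqP -> := h (Ordinal kt).
Qed.

(** * Shadows of lexicographic segments *)

Local Arguments iota : simpl never.

Lemma count_sum (T : Type) (a : pred T) (s : seq T) : count a s = \sum_(x <- s) a x.
Proof. by elim: s => [|x s IH]; rewrite ?big_nil // big_cons /= IH. Qed.

(* Exponent vectors of the monomials of degree [d] in [n] variables, listed in
   decreasing lexicographic order; [j] is the degree in the last variables. *)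
Fixpoint lexmon (n d : nat) : seq (seq nat) :=
  if n is n'.+1 then
    flatten [seq [seq (d - j) :: v | v <- lexmon n' j] | j <- iota 0 d.+1]
  else if d == 0 then [:: [::]] else [::].

(* For [p = q], the exponent vectors of the projectively reduced monomials of
   large degree, with the exponent of the last variable truncated to [q]; they
   correspond to the points of the projective space.  The exponent of the first
   variable is bounded by [p - 1] instead of [q - 1]. *)
Fixpoint points (q n p : nat) : seq (seq nat) :=
  if n is n'.+1 then
    (q :: nseq n' 0) ::
      flatten [seq [seq i :: a | a <- points q n' q] | i <- rev (iota 0 p)]
  else [::].

Arguments lexmon : simpl never.
Arguments points : simpl never.

Lemma lexmonS n d : lexmon n.+1 d =
  flatten [seq [seq (d - j) :: v | v <- lexmon n j] | j <- iota 0 d.+1].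
Proof. by []. Qed.

Lemma pointsS q n p : points q n.+1 p = (q :: nseq n 0) ::
  flatten [seq [seq i :: a | a <- points q n q] | i <- rev (iota 0 p)].
Proof. by []. Qed.

Definition upset (n d : nat) (S : pred (seq nat)) (a : seq nat) : bool :=
  has (fun v => S v && all2 leq v a) (lexmon n d).

Definition shadow (q n p d : nat) (S : pred (seq nat)) : nat :=
  count (upset n d S) (points q n p).

Definition lexseg (n d r : nat) : pred (seq nat) := fun v => v \in take r (lexmon n d).

Definition lexshadow (q n p d r : nat) : nat := shadow q n p d (lexseg n d r).

Definition nmon (n d : nat) : nat := size (lexmon n d).

(** Rows are indexed by the degree [j] left for the other variables, so that increasing [j] follows
    the decreasing lexicographic order. *)
Definition row (S : pred (seq nat)) (d j : nat) : pred (seq nat) :=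
  fun v => S ((d - j) :: v).

Lemma mem_lexmon n d v : (v \in lexmon n d) = (size v == n) && (sumn v == d).
Proof.
elim: n d v => [|n IH] d v; first by case: d; case: v.
rewrite lexmonS; apply/flatten_mapP/idP => [[j jd /mapP[w]]|].
  rewrite IH => /andP[/eqP sw /eqP nw] -> /=; rewrite sw nw eqxx /=.
  by move: jd; rewrite mem_iota; lia.
case: v => [|x v] //=; rewrite eqSS => /andP[sv /eqP nv].
exists (sumn v); first by rewrite mem_iota; lia.
by apply/mapP; exists v; [rewrite IH sv eqxx|congr (_ :: _); lia].
Qed.

Lemma lexmon_uniq n d : uniq (lexmon n d).
Proof.
elim: n d => [|n IH] d; first by case: d.
rewrite lexmonS.
have gen m j0 : j0 + m <= d.+1 ->
    uniq (flatten [seq [seq (d - j) :: v | v <- lexmon n j] | j <- iota j0 m]).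
  elim: m j0 => [|m IHm] j0 // jm.
  rewrite -[iota _ m.+1]/(j0 :: iota j0.+1 m) /= cat_uniq IHm ?addSnnS // andbT.
  rewrite map_inj_uniq; last by move=> x y [].
  rewrite IH /=; apply/hasPn => v /flatten_mapP[j jj /mapP[w _ ->]].
  by apply/mapP => -[w' _ [e _]]; move: jj; rewrite mem_iota; lia.
exact: gen.
Qed.

Lemma lexmon0 n : lexmon n 0 = [:: nseq n 0].
Proof. by elim: n => // n IH; rewrite lexmonS -[iota _ _]/[:: 0] /= IH. Qed.

Lemma big_lexmonS n d (G : seq nat -> nat) :
  \sum_(v <- lexmon n.+1 d) G v =
  \sum_(0 <= j < d.+1) \sum_(v <- lexmon n j) G ((d - j) :: v).
Proof.
rewrite lexmonS big_flatten big_map /index_iota subn0.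
by apply: eq_bigr => j _; rewrite big_map.
Qed.

Lemma count_lexmonS n d (S : pred (seq nat)) :
  count S (lexmon n.+1 d) = \sum_(0 <= j < d.+1) count (row S d j) (lexmon n j).
Proof.
rewrite count_sum big_lexmonS; apply: eq_bigr => j _.
by rewrite count_sum.
Qed.

Lemma nmonS n d : nmon n.+1 d = psum (nmon n) d.+1.
Proof.
rewrite /nmon -count_predT count_lexmonS; apply: eq_bigr => j _.
exact: count_predT.
Qed.

Lemma nmon0 n : nmon n 0 = 1. Proof. by rewrite /nmon lexmon0. Qed.

Lemma eq_upset n d S S' a : {in lexmon n d, S =1 S'} -> upset n d S a = upset n d S' a.
Proof. by move=> h; apply: eq_in_has => v /h ->. Qed.

Lemma eq_shadow q n p d S S' : {in lexmon n d, S =1 S'} ->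
  shadow q n p d S = shadow q n p d S'.
Proof. by move=> h; apply: eq_count => a; exact: eq_upset. Qed.

Lemma upset_cons n d S i a : upset n.+1 d S (i :: a) =
  has (fun j => (d - j <= i) && upset n j (row S d j) a) (iota 0 d.+1).
Proof.
apply/hasP/hasP => [[v]|[j jd /andP[ji /hasP[v vn /andP[Sv va]]]]]; last first.
  exists ((d - j) :: v); last by rewrite [S _]Sv /= ji.
  by move: vn jd; rewrite !mem_lexmon mem_iota /= eqSS => /andP[-> /eqP->]; lia.
rewrite mem_lexmon; case: v => [|x v] //=; rewrite eqSS => /andP[sv /eqP nv].
move=> /andP[Sv /andP[xi va]]; exists (sumn v); first by rewrite mem_iota; lia.
have e : d - sumn v = x by lia.
rewrite e xi /=; apply/hasP; exists v; first by rewrite mem_lexmon sv eqxx.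
by rewrite /row e Sv.
Qed.

Lemma all2_leq_nseq0 n v : size v = n -> all2 leq v (nseq n 0) = (v == nseq n 0).
Proof. by elim: n v => [|n IH] [|x v] //= [sv]; rewrite IH // leqn0 eqseq_cons. Qed.

Lemma sumn_nseq0 n : sumn (nseq n 0) = 0.
Proof. by rewrite sumn_nseq mul0n. Qed.

(** The head point stands for a pure power of [x_0], and [x_0^d] is the only monomial of degree [d]
    that can lie below it. *)
Lemma upset_head q n d S : d <= q -> upset n.+1 d S (q :: nseq n 0) = S (d :: nseq n 0).
Proof.
move=> dq; apply/hasP/idP => [[v]|Sd]; last first.
  exists (d :: nseq n 0); first by rewrite mem_lexmon /= size_nseq sumn_nseq0 addn0 !eqxx.
  by rewrite Sd /= dq all2_leq_nseq0 ?size_nseq ?eqxx.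
rewrite mem_lexmon; case: v => [|x v] //=; rewrite eqSS => /andP[/eqP sv /eqP nv].
move=> /and3P[Sv _]; rewrite all2_leq_nseq0 // => /eqP e.
by move: Sv nv; rewrite e sumn_nseq0 addn0 => ? <-.
Qed.

Lemma count_points q n p (P : pred (seq nat)) :
  count P (points q n.+1 p) =
  P (q :: nseq n 0) + \sum_(0 <= i < p) count (fun a => P (i :: a)) (points q n q).
Proof.
rewrite pointsS /= count_sum big_flatten big_map big_rev /= /index_iota subn0.
by congr (_ + _); apply: eq_bigr => i _; rewrite big_map count_sum.
Qed.

Lemma shadowS q n p d S : d <= q -> shadow q n.+1 p d S = S (d :: nseq n 0) +
  \sum_(0 <= i < p) count (fun a =>
    has (fun j => (d - j <= i) && upset n j (row S d j) a) (iota 0 d.+1)) (points q n q).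
Proof.
move=> dq; rewrite /shadow count_points upset_head //; congr (_ + _).
by apply: eq_bigr => i _; apply: eq_count => a; rewrite upset_cons.
Qed.

Lemma upset_total q n p d S a : d <= q -> {in lexmon n d, S =1 predT} ->
  a \in points q n p -> upset n d S a.
Proof.
move=> dq h; rewrite (eq_upset _ h) {h}.
elim: n p a => [|n IH] p a //; rewrite pointsS inE => /orP[/eqP->|]; first by rewrite upset_head.
move=> /flatten_mapP[i _ /mapP[b bp ->]]; rewrite upset_cons; apply/hasP.
by exists d; rewrite ?mem_iota ?ltnSn // subnn leq0n; exact: IH bp.
Qed.

Lemma shadow_total q n p d S : d <= q -> {in lexmon n d, S =1 predT} ->
  shadow q n p d S = size (points q n p).
Proof.
move=> dq h; apply/eqP; rewrite -all_count; apply/allP => a; exact: upset_total.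
Qed.

Lemma shadow_le q n p d S : shadow q n p d S <= size (points q n p).
Proof. exact: count_size. Qed.

Lemma shadow_mono q n p d (S S' : pred (seq nat)) : {in lexmon n d, forall v, S v -> S' v} ->
  shadow q n p d S <= shadow q n p d S'.
Proof.
move=> h; apply: sub_count => a /hasP[v vn /andP[Sv va]].
by apply/hasP; exists v => //; rewrite h.
Qed.

Lemma lexseg_total n d r : nmon n d <= r -> {in lexmon n d, lexseg n d r =1 predT}.
Proof. by move=> h v vn; rewrite /lexseg take_oversize. Qed.

Lemma lexshadow0 q n p d : lexshadow q n p d 0 = 0.
Proof.
apply/eqP; rewrite -leqn0 leqNgt -has_count; apply/hasPn => a _.
by apply/hasPn => v _; rewrite /lexseg take0.
Qed.

Lemma lexshadow_full q n p d r : d <= q -> nmon n d <= r ->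
  lexshadow q n p d r = size (points q n p).
Proof. by move=> dq h; apply: shadow_total => //; exact: lexseg_total. Qed.

Lemma lexseg_mono n d r s v : r <= s -> lexseg n d r v -> lexseg n d s v.
Proof.
move=> rs; rewrite /lexseg -(cat_take_drop r (take s (lexmon n d))).
by rewrite take_takel // mem_cat => ->.
Qed.

Lemma lexshadow_mono q n p d r s : r <= s -> lexshadow q n p d r <= lexshadow q n p d s.
Proof. by move=> rs; apply: shadow_mono => v _; exact: lexseg_mono. Qed.

(** In the list, row [j] is preceded by the [psum (nmon n) j] monomials of the earlier rows. *)
Lemma lexseg_row n d r j v : j <= d -> 
  lexseg n.+1 d r ((d - j) :: v) = lexseg n j (r - psum (nmon n) j) v.
Proof.
move=> jd; rewrite /lexseg lexmonS.
have gen m j0 s : j0 <= j < j0 + m -> j0 + m <= d.+1 ->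
  ((d - j) :: v \in take s (flatten [seq [seq (d - i) :: v | v <- lexmon n i] | i <- iota j0 m]))
  = (v \in take (s - \sum_(j0 <= i < j) nmon n i) (lexmon n j)).
  elim: m j0 s => [|m IH] j0 s; first by lia.
  move=> /andP[]; rewrite leq_eqVlt => /orP[/eqP e|j0j] jm jd'; last first.
    rewrite -[iota _ m.+1]/(j0 :: iota j0.+1 m) map_cons [flatten _]/= take_cat size_map (big_ltn j0j).
    have notin l : ((d - j) :: v \in [seq (d - j0) :: v | v <- l]) = false.
      by apply/mapP => -[w _ [e _]]; lia.
    case: ltnP => h; last first.
      by rewrite mem_cat notin /= IH ?subnDA //; lia.
    have -> : s - (nmon n j0 + \sum_(j0.+1 <= i < j) nmon n i) = 0 by rewrite /nmon; lia.
    by rewrite take0 -map_take notin.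
  rewrite -[iota _ m.+1]/(j0 :: iota j0.+1 m) map_cons [flatten _]/= take_cat size_map e big_geq // subn0.
  have cinj : injective (cons (d - j)) by move=> ? ? [].
  have memin l : ((d - j) :: v \in [seq (d - j) :: v | v <- l]) = (v \in l).
    exact: mem_map.
  case: ltnP => h; first by rewrite -map_take memin.
  rewrite mem_cat memin [take s (lexmon n j)]take_oversize //; case: (v \in lexmon n j) => //=.
  apply/negP => /mem_take /flatten_mapP[i]; rewrite mem_iota => ii /mapP[w _ [e' _]].
  by lia.
by rewrite (gen d.+1 0 r) //; lia.
Qed.

(** * Nested sets of points *)

Definition prefix_closed (T : Type) (P : pred T) (l : seq T) : bool :=
  pairwise (fun x y => P y ==> P x) l.

Lemma prefix_closed_or (T : Type) (P Q : pred T) l :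
  prefix_closed P l -> prefix_closed Q l -> prefix_closed (fun a => P a || Q a) l.
Proof.
elim: l => //= x l IH /andP[aP pP] /andP[aQ pQ]; rewrite [X in _ && X]IH // andbT.
elim: l aP aQ {pP pQ IH} => //= y l IH /andP[hP aP] /andP[hQ aQ].
by rewrite IH // andbT; move: hP hQ; case: (P y); case: (Q y); case: (P x); case: (Q x).
Qed.

Lemma count_prefix_closed_or (T : Type) (P Q : pred T) l :
  prefix_closed P l -> prefix_closed Q l ->
  count (fun a => P a || Q a) l = maxn (count P l) (count Q l).
Proof.
have zero x (R : pred T) s : R x = false -> all (fun y => R y ==> R x) s ->
    count R s = 0.
  move=> Rx al; elim: s al => //= y s IH /andP[hy al]; rewrite IH // addn0.
  by move: hy; rewrite Rx; case: (R y).
elim: l => [|x l IH] //= /andP[aP pP] /andP[aQ pQ]; rewrite IH //.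
case Px: (P x); case Qx: (Q x) => /=; first by lia.
- by rewrite (zero x Q l Qx aQ); lia.
- by rewrite (zero x P l Px aP); lia.
- by [].
Qed.

(** Initial parts of one list are nested, so a finite union of them is the largest one. *)
Lemma count_has_prefix_closed (T : Type) (I : eqType) (r : seq I) (C : pred I)
    (P : I -> pred T) (l : seq T) :
  {in r, forall j, C j -> prefix_closed (P j) l} ->
  prefix_closed (fun a => has (fun j => C j && P j a) r) l /\
  count (fun a => has (fun j => C j && P j a) r) l = \max_(j <- r | C j) count (P j) l.
Proof.
elim: r => [|j r IH] h.
  rewrite big_nil /= count_pred0; split => //.
  by rewrite /prefix_closed; elim: l {h} => //= x l ->; rewrite andbT all_predT.
have [IH1 IH2] : prefix_closed (fun a => has (fun j => C j && P j a) r) l /\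
  count (fun a => has (fun j => C j && P j a) r) l = \max_(j <- r | C j) count (P j) l.
  by apply: IH => i ir; apply: h; rewrite inE ir orbT.
rewrite big_cons /=; case: ifP => Cj; last by [].
have pj := h j (mem_head _ _) Cj; split; first exact: prefix_closed_or.
by rewrite /= count_prefix_closed_or // IH2.
Qed.

Lemma rev_iotaS p : rev (iota 0 p.+1) = p :: rev (iota 0 p).
Proof. by rewrite -addn1 iotaD rev_cat. Qed.

Lemma lexseg_nonempty n d r a : upset n d (lexseg n d r) a -> 0 < r.
Proof. by case: r => // /hasP[v _]; rewrite /lexseg take0. Qed.

Lemma eq_upset_lexseg_row n d r j a : j <= d ->
  upset n j (row (lexseg n.+1 d r) d j) a = upset n j (lexseg n j (r - psum (nmon n) j)) a.
Proof. by move=> jd; apply: eq_upset => v _; rewrite /row lexseg_row. Qed.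

(** A segment reaching a point whose first exponent is below [p] has already exhausted the row
    [d - p], so all points with first exponent [p] lie above it. Among points with equal first
    exponent, the rows give initial parts by induction, and so does their union. *)
Lemma lexseg_prefix_closed q n p d r : d <= q ->
  prefix_closed (upset n d (lexseg n d r)) (points q n p).
Proof.
elim: n p d r => [|n IH] p d r dq //.
rewrite /prefix_closed pointsS pairwise_cons; apply/andP; split.
  apply/allP => a _; apply/implyP => /lexseg_nonempty r0; rewrite upset_head //.
  have := @lexseg_row n d r 0 (nseq n 0) (leq0n d).
  rewrite subn0 => ->; apply: lexseg_total; last by rewrite lexmon0 mem_head.
  by rewrite nmon0 /psum big_nil subn0.
elim: p => [|p IHp] //; rewrite rev_iotaS map_cons [flatten _]/= pairwise_cat.
apply/and3P; split=> //.
  apply/allrelP => x y /mapP[a ap ->] /flatten_mapP[i].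
  rewrite mem_rev mem_iota => /andP[_ ip] /mapP[b bp ->]; apply/implyP.
  rewrite !upset_cons => /hasP[j]; rewrite mem_iota => jd /andP[ji].
  rewrite eq_upset_lexseg_row; last lia; move=> /lexseg_nonempty rj.
  apply/hasP; exists (d - p); first by rewrite mem_iota; lia.
  apply/andP; split; first lia.
  rewrite eq_upset_lexseg_row; last lia.
  apply: upset_total ap; first lia.
  (* Row [d - p] comes before the nonempty row [j] and is complete, unless truncated subtraction
     makes both indices 0; row 0 has one monomial. *)
  apply: lexseg_total.
  case: (ltnP (d - p) j) => h.
    by have := @psum_mono (nmon n) (d - p).+1 j h; rewrite psumS; lia.
  have [e1 e2] : j = 0 /\ d - p = 0 by lia.
  by move: rj; rewrite e1 e2 nmon0 /psum big_nil; lia.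
rewrite pairwise_map.
have := @count_has_prefix_closed _ _ (iota 0 d.+1) (fun j => d - j <= p)
   (fun j => upset n j (lexseg n j (r - psum (nmon n) j))) (points q n q).
case=> [j|]; first by rewrite mem_iota => jd _; apply: IH; lia.
rewrite /prefix_closed => + _.
have e : (fun a => has (fun j => (d - j <= p) && upset n j (lexseg n j (r - psum (nmon n) j)) a)
   (iota 0 d.+1)) =1 (fun a => upset n.+1 d (lexseg n.+1 d r) (p :: a)).
  move=> a; rewrite upset_cons; apply: eq_in_has => j; rewrite mem_iota => jd.
  by rewrite eq_upset_lexseg_row //; lia.
by apply: sub_pairwise => x y /=; rewrite -!e.
Qed.

Definition rowlex (n d : nat) (s : nat -> nat) : pred (seq nat) :=
  fun v => if v is i :: w then lexseg n (d - i) (s (d - i)) w else false.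

(** The number of points above [rowlex], with a maximum in place of a union because the sets are
    nested. The first summand accounts for the point [(q, 0, ..., 0)]. *)
Definition rowshadow (q n p d : nat) (s : nat -> nat) : nat :=
  (0 < s 0) + \sum_(0 <= i < p) \max_(j <- iota 0 d.+1 | d - j <= i) lexshadow q n q j (s j).

Lemma row_rowlex n d s j v : j <= d -> row (rowlex n d s) d j v = lexseg n j (s j) v.
Proof. by move=> jd; rewrite /row /rowlex subKn. Qed.

Lemma lexseg_count n d r : count (lexseg n d r) (lexmon n d) = minn r (nmon n d).
Proof.
rewrite /lexseg -{2}(cat_take_drop r (lexmon n d)) count_cat.
have := lexmon_uniq n d; rewrite -{1}(cat_take_drop r (lexmon n d)) cat_uniq.
move=> /and3P[_ /hasPn h _].
have -> : count (fun v => v \in take r (lexmon n d)) (drop r (lexmon n d)) = 0.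
  by apply/eqP; rewrite -leqn0 leqNgt -has_count; apply/hasPn => v /h.
have -> : count (fun v => v \in take r (lexmon n d)) (take r (lexmon n d)) = size (take r (lexmon n d)).
  by apply/eqP; rewrite -all_count; apply/allP.
by rewrite addn0 size_take_min.
Qed.

Lemma lexseg_head n r : lexseg n 0 r (nseq n 0) = (0 < r).
Proof. by rewrite /lexseg lexmon0; case: r => //= r; rewrite inE eqxx. Qed.

Lemma shadow_rowlex q n p d s : d <= q ->
  shadow q n.+1 p d (rowlex n d s) = rowshadow q n p d s.
Proof.
move=> dq; rewrite shadowS //; congr (_ + _).
  by rewrite /= subnn lexseg_head.
apply: eq_bigr => i _.
have [|_ <-] := @count_has_prefix_closed _ _ (iota 0 d.+1) (fun j => d - j <= i)
   (fun j => upset n j (lexseg n j (s j))) (points q n q).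
  by move=> j; rewrite mem_iota => jd _; apply: lexseg_prefix_closed; lia.
apply: eq_count => a; apply: eq_in_has => j; rewrite mem_iota => jd.
by congr (_ && _); apply: eq_upset => v _; rewrite row_rowlex //; lia.
Qed.

Lemma lexshadowE q n p d r : d <= q -> lexshadow q n.+1 p d r =
  rowshadow q n p d (fun j => r - psum (nmon n) j).
Proof.
move=> dq; rewrite -shadow_rowlex //; apply: eq_shadow => v.
rewrite mem_lexmon; case: v => [|i v] //= /andP[_ /eqP nv].
have {1}-> : i = d - (d - i) by lia.
by rewrite lexseg_row //; lia.
Qed.

(** The points with first exponent [i] are decided by row [d - i] alone, since a later row is
    nonempty only once that row is complete. For [i >= d] all of them are covered as soon as
    [0 < r]. *)
Lemma lexshadow_rec q n p d r : d <= q -> d <= p -> lexshadow q n.+1 p d r =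
  (0 < r) * (1 + (p - d) * size (points q n q)) +
  \sum_(1 <= j < d.+1) lexshadow q n q j (r - psum (nmon n) j).
Proof.
move=> dq dp; rewrite lexshadowE // /rowshadow {1}/psum big_nil subn0.
rewrite mulnDr muln1 -addnA; congr (_ + _).
have maxE i : \max_(j <- iota 0 d.+1 | d - j <= i) lexshadow q n q j (r - psum (nmon n) j) =
    lexshadow q n q (d - i) (r - psum (nmon n) (d - i)).
  apply/eqP; rewrite eqn_leq; apply/andP; split; last first.
    apply: (@leq_bigmax_seq _ _ _ (fun j => lexshadow q n q j (r - psum (nmon n) j))); last lia.
    by rewrite mem_iota; lia.
  apply/bigmax_leqP_seq => j; rewrite mem_iota => jd ji.
  case: (ltnP (d - i) j) => h; last first.
    by have -> : j = d - i by lia.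
  case: (leqP r (psum (nmon n) j)) => rj.
    by move: rj; rewrite -subn_eq0 => /eqP->; rewrite lexshadow0.
  apply: leq_trans (shadow_le _ _ _ _ _) _.
  rewrite lexshadow_full //; first lia.
  by have := @psum_mono (nmon n) (d - i).+1 j h; rewrite psumS; lia.
rewrite (eq_bigr _ (fun i _ => maxE i)) (big_cat_nat (n := d)) //= addnC; congr (_ + _).
  rewrite (@big_nat_const_eq _ _ ((0 < r) * size (points q n q))); first by lia.
  move=> i /andP[di _]; have -> : d - i = 0 by lia.
  rewrite /psum big_nil subn0; case: (r) => [|r']; first by rewrite lexshadow0.
  by rewrite mul1n lexshadow_full // nmon0.
rewrite big_nat_rev /= add0n big_add1 /= big_nat [RHS]big_nat.
by apply: eq_bigr => i /andP[_ id]; have -> : d - (d - i.+1) = i.+1 by lia.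
Qed.

Lemma rowlex_count n d s : (forall j, j <= d -> s j <= nmon n j) ->
  count (rowlex n d s) (lexmon n.+1 d) = \sum_(0 <= j < d.+1) s j.
Proof.
move=> h; rewrite count_lexmonS big_nat [RHS]big_nat; apply: eq_bigr => j /andP[_ jd].
rewrite (eq_count (a2 := lexseg n j (s j))); last by move=> v; rewrite row_rowlex.
by rewrite lexseg_count; apply/minn_idPl/h.
Qed.

(** * Compression in the first two variables *)

Lemma size_pointsS q n p : size (points q n.+1 p) = 1 + p * size (points q n q).
Proof.
rewrite -count_predT count_points /=; congr (_ + _).
by rewrite (@big_nat_const_eq _ _ (size (points q n q))) ?subn0 // => i _; rewrite count_predT.
Qed.

Lemma nmon1 d : nmon 1 d = 1.
Proof.
rewrite nmonS psumS; case: d => [|d]; first by rewrite /psum big_nil.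
rewrite [nmon 0 _]/= addn0.
by elim: d => [|d IH]; rewrite psumS ?IH // /psum big_nil.
Qed.

Lemma lexshadow_no_var q p d r : lexshadow q 0 p d r = 0.
Proof. by []. Qed.

Lemma lexshadow1 q d r : d <= q -> lexshadow q 1 q d r = (0 < r).
Proof.
move=> dq; rewrite lexshadow_rec //= muln0 addn0 muln1 big1 ?addn0 // => j _.
Qed.

Lemma eq_block_law q w nu nu' f : nu =1 nu' -> block_law q w nu f -> block_law q w nu' f.
Proof.
move=> e [h1 h2 h3 h4 h5 h6 h7 h8 h9]; split=> //; first by move=> k t; rewrite -e; exact: h3.
- by rewrite -e.
- by move=> k; rewrite -!e; exact: h5.
- by move=> k L b; rewrite -!e; exact: h8.
- by move=> k L; rewrite -!e; exact: h9.
Qed.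

(** The recursion [lexshadow_rec] is the concatenation of [block_law_step]. The induction starts
    with one variable, where [nmon] is constantly 1; with no variable it drops from 1 to 0. *)
Lemma lexshadow_block_law q n : 0 < q ->
  block_law q (size (points q n.+1 q)) (nmon n.+1) (lexshadow q n.+1 q).
Proof.
move=> q0; elim: n => [|n IH].
  rewrite size_pointsS muln0 addn0.
  split=> [k kq|k s t kq st|k t kq|//|k kq|k t kq|k y h kq|k L b kq|k L kq];
    rewrite ?nmon1 ?lexshadow1 //; try lia.
rewrite size_pointsS; apply: (eq_block_law (fun k => esym (nmonS n.+1 k))).
apply: (block_law_step IH q0) => k r kq.
by rewrite lexshadow_rec //; exact: ltnW.
Qed.

Lemma lexshadow_exchange q n k d s b x : k < d -> d < q -> 0 < b -> b <= s ->
  s < nmon n k -> x = minn b (nmon n k - s) ->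
  lexshadow q n q d (b - x) + lexshadow q n q k (s + x) <=
  lexshadow q n q d b + lexshadow q n q k s.
Proof.
case: n => [|[|n]]; first by rewrite !lexshadow_no_var.
  by rewrite nmon1; lia.
move=> kd dq b0 bs; rewrite nmonS => sk ex.
have q0 : 0 < q by lia.
apply: (block_exchange (lexshadow_block_law n q0) q0) ex => //.
by move=> l r lq; rewrite lexshadow_rec //; exact: ltnW.
Qed.

Definition compress01 (S : pred (seq nat)) : pred (seq nat) := fun v =>
  if v is i :: k :: w then
    initial_seg (i + k) (fun k' => S ((i + k - k') :: k' :: w)) k
  else false.

Lemma triangle_sum m (X : nat -> nat -> nat) :
  \sum_(0 <= a < m) \sum_(0 <= b < a.+1) X a b =
  \sum_(0 <= b < m) \sum_(0 <= k < m - b) X (b + k) b.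
Proof.
elim: m => [|m IH]; first by rewrite !big_nil.
rewrite big_nat_recr //= IH [RHS]big_nat_recr //= subSn // subnn big_nat1 addn0.
rewrite big_nat_recr //= addnA -big_split /=; congr (_ + _).
rewrite big_nat [RHS]big_nat; apply: eq_bigr => b /andP[_ bm].
by rewrite subSn ?(ltnW bm) // big_nat_recr //= subnKC // ltnW.
Qed.

Lemma big_lexmonSS n d (G : seq nat -> nat) :
  \sum_(v <- lexmon n.+2 d) G v =
  \sum_(0 <= j < d.+1) \sum_(w <- lexmon n j)
    \sum_(0 <= k < (d - j).+1) G ((d - j - k) :: k :: w).
Proof.
rewrite big_lexmonS.
under eq_bigr => j1 _ do rewrite big_lexmonS.
rewrite triangle_sum big_nat [RHS]big_nat; apply: eq_bigr => j /andP[_ jd].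
rewrite exchange_big /=; apply: eq_bigr => w _.
rewrite subSn // big_nat [RHS]big_nat; apply: eq_bigr => k _.
by rewrite subnDA addKn.
Qed.

Lemma compress01E S t k w : k <= t ->
  compress01 S ((t - k) :: k :: w) = initial_seg t (fun k' => S ((t - k') :: k' :: w)) k.
Proof. by move=> kt; rewrite /= subnK. Qed.

Lemma count_compress01 n d S :
  count (compress01 S) (lexmon n.+2 d) = count S (lexmon n.+2 d).
Proof.
rewrite !count_sum !big_lexmonSS; apply: eq_bigr => j _; apply: eq_bigr => w _.
have e := count_initial_seg (d - j) (fun k => S ((d - j - k) :: k :: w)).
rewrite !count_sum in e.
rewrite /index_iota subn0 -{}e -[iota _ _]/(iota 0 _) big_seq [RHS]big_seq.
apply: eq_bigr => k; rewrite mem_iota => /andP[_ kd].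
by rewrite compress01E.
Qed.

Definition lowmon (n d : nat) : seq (seq nat) := flatten [seq lexmon n j | j <- iota 0 d.+1].

Lemma mem_lowmon n d w : (w \in lowmon n d) = (size w == n) && (sumn w <= d).
Proof.
apply/flatten_mapP/andP => [[j]|[sw nw]].
  by rewrite mem_iota mem_lexmon => jd /andP[-> /eqP->]; lia.
by exists (sumn w); rewrite ?mem_iota ?mem_lexmon ?sw ?eqxx //; lia.
Qed.

(** For a fixed tail [a], each tail [w] dividing [a] contributes generators [x_0^i x_1^k] with
    [i + k = d - sumn w], all on one antidiagonal of the plane. *)
Lemma upset_stair n d S i b a : upset n.+2 d S (i :: b :: a) =
  stair [seq w <- lowmon n d | all2 leq w a]
    (fun w => d - sumn w) (fun w k => S ((d - sumn w - k) :: k :: w)) i b.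
Proof.
apply/hasP/hasP => [[[|x [|k w]] vm sv]|[w]].
- by rewrite mem_lexmon in vm.
- by rewrite mem_lexmon in vm.
- have [sw nw] : size w = n /\ x + (k + sumn w) = d.
    by move: vm; rewrite mem_lexmon => /andP[/eqP[] ? /eqP].
  have [Sv xi kb wa] : [/\ S [:: x, k & w], x <= i, k <= b & all2 leq w a].
    exact/and4P.
  exists w; first by rewrite mem_filter wa mem_lowmon sw eqxx; lia.
  apply/hasP; exists k; first by rewrite mem_iota; lia.
  have -> : d - sumn w - k = x by lia.
  by rewrite Sv xi kb.
rewrite mem_filter mem_lowmon => /and3P[wa sw nw] /hasP[k].
rewrite mem_iota => kd /and3P[Sk h1 h2].
exists ((d - sumn w - k) :: k :: w); last by rewrite Sk /= h1 h2.
by rewrite mem_lexmon /= !eqSS sw /=; lia.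
Qed.

Lemma sum_leq_indicator c p : \sum_(0 <= i < p) (c <= i) = p - c.
Proof.
elim: p => [|p IH]; first by rewrite big_nil.
by rewrite big_nat_recr //= IH; lia.
Qed.

(** This treats the points [(i, q, 0, ..., 0)] and [(q, 0, ..., 0)], which lie in no plane section.
    For the former only the largest [k] in [P] matters: among [s] elements it is at least [s - 1],
    and at least [s] if 0 is not in [P], which pays for the point gained by the initial segment. *)
Lemma line_compression d p (P : pred nat) : d < p ->
  initial_seg d P 0 + \sum_(0 <= i < p)
     has (fun k => initial_seg d P k && (d - k <= i)) (iota 0 d.+1) <=
  P 0 + \sum_(0 <= i < p) has (fun k => P k && (d - k <= i)) (iota 0 d.+1).
Proof.
move=> dp; rewrite /initial_seg; set s := count P _.
case: (posnP s) => s0.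
  by rewrite s0 /= big1 // => i _; rewrite (eq_has (a2 := pred0)) ?has_pred0.
have ex : exists k, P k && (k <= d).
  have : 0 < count P (iota 0 d.+1) by [].
  by rewrite -has_count => /hasP[k]; rewrite mem_iota => kd Pk; exists k; rewrite Pk.
have bd k : P k && (k <= d) -> k <= d by case/andP.
case: (ex_maxnP ex bd) => k1 /andP[Pk1 k1d] k1max.
have sk : s <= k1 + P 0.
  have le : s <= count P (iota 0 k1.+1).
    rewrite /s (_ : d.+1 = k1.+1 + (d - k1)); last lia.
    rewrite iotaD count_cat -[X in _ <= X]addn0 leq_add2l leqNgt -has_count.
    apply/hasPn => k; rewrite mem_iota => kk; apply/negP => Pk.
    by have := k1max k; rewrite Pk /=; lia.
  apply: leq_trans le _; rewrite -[iota 0 k1.+1]/(0 :: iota 1 k1) /= addnC leq_add2r.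
  by rewrite -[X in _ <= X](size_iota 1 k1) count_size.
have e1 i : has (fun k => P k && (d - k <= i)) (iota 0 d.+1) = (d - k1 <= i).
  apply/hasP/idP => [[k]|h].
    rewrite mem_iota => kd /andP[Pk h]; have := k1max k; rewrite Pk /=; lia.
  by exists k1; rewrite ?Pk1 // mem_iota; lia.
have sd : s <= d.+1 by rewrite -[X in _ <= X](size_iota 0 d.+1) count_size.
have e2 i : has (fun k => (k < s) && (d - k <= i)) (iota 0 d.+1) = (d - s.-1 <= i).
  apply/hasP/idP => [[k _]|h]; first by lia.
  by exists s.-1; rewrite ?mem_iota; lia.
rewrite (eq_bigr _ (fun i _ => congr1 nat_of_bool (e1 i))).
rewrite (eq_bigr _ (fun i _ => congr1 nat_of_bool (e2 i))) !sum_leq_indicator /=.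
lia.
Qed.

Lemma upset_line q n d S i : d <= q -> upset n.+2 d S (i :: q :: nseq n 0) =
  has (fun k => S ((d - k) :: k :: nseq n 0) && (d - k <= i)) (iota 0 d.+1).
Proof.
move=> dq; rewrite upset_cons; apply: eq_in_has => k; rewrite mem_iota => kd.
by rewrite upset_head 1?andbC //; lia.
Qed.

Lemma shadow_compress01 q n p d S : d < p -> p <= q ->
  shadow q n.+2 p d (compress01 S) <= shadow q n.+2 p d S.
Proof.
move=> dp pq; have dq : d <= q by lia.
(* The points split into the line just treated and one plane for each tail [a]. *)
have E R : shadow q n.+2 p d R = (R (d :: nseq n.+1 0) +
    \sum_(0 <= i < p) has (fun k => R ((d - k) :: k :: nseq n 0) && (d - k <= i)) (iota 0 d.+1))
  + \sum_(a <- points q n q) \sum_(0 <= i < p) \sum_(0 <= b < q) upset n.+2 d R (i :: b :: a).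
  rewrite /shadow count_points upset_head // -addnA; congr (_ + _).
  rewrite [X in _ = _ + X]exchange_big -big_split; apply: eq_bigr => i _.
  rewrite count_points upset_line // [X in _ = _ + X]exchange_big; congr (_ + _).
  by apply: eq_bigr => b _; rewrite count_sum.
rewrite !E; apply: leq_add.
  have := line_compression (fun k => S ((d - k) :: k :: nseq n 0)) dp.
  congr (_ + _ <= _ + _).
  - by rewrite /= addn0.
  - apply: eq_bigr => i _; congr nat_of_bool; apply: eq_in_has => k.
    by rewrite mem_iota => kd; rewrite compress01E //; lia.
  - by rewrite subn0.
apply: leq_sum => a _.
set zs := [seq w <- lowmon n d | all2 leq w a].
have := @stair_compression _ zs (fun w => d - sumn w)
  (fun w k => S ((d - sumn w - k) :: k :: w)) p q pq.
have tp z : z \in zs -> d - sumn z < p by lia.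
move=> /(_ tp); congr (_ <= _); apply: eq_bigr => i _; apply: eq_bigr => b _; last first.
  by rewrite upset_stair.
rewrite upset_stair; congr nat_of_bool; apply: eq_has => w; apply: eq_in_has => k.
by rewrite mem_iota => kd; rewrite compress01E //; lia.
Qed.

(** The total degree of [S] in the variables other than [x_0]: it falls when exponents are shifted
    to [x_0]. *)
Definition weight (d : nat) (S : pred (seq nat)) (l : seq (seq nat)) : nat :=
  \sum_(v <- l) S v * (d - head 0 v).

Lemma weight_rows n d S : weight d S (lexmon n.+1 d) =
  \sum_(0 <= j < d.+1) j * count (row S d j) (lexmon n j).
Proof.
rewrite /weight big_lexmonS big_nat [RHS]big_nat; apply: eq_bigr => j /andP[_ jd].
rewrite count_sum big_distrr /=; apply: eq_bigr => v _; rewrite subKn //.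
exact: mulnC.
Qed.

Lemma sum_leq_eq (I : eqType) (r : seq I) (a b : I -> nat) :
  {in r, forall i, a i <= b i} -> \sum_(i <- r) b i <= \sum_(i <- r) a i ->
  {in r, forall i, a i = b i}.
Proof.
elim: r => // x r IH h; rewrite !big_cons => le.
have hr : {in r, forall i, a i <= b i} by move=> i ir; apply: h; rewrite inE ir orbT.
have hx : a x <= b x by apply: h; rewrite inE eqxx.
have sr : \sum_(i <- r) a i <= \sum_(i <- r) b i by rewrite big_seq [X in _ <= X]big_seq; apply: leq_sum.
move=> i; rewrite inE => /orP[/eqP->|ir]; first by lia.
by apply: IH => //; lia.
Qed.

Lemma weight_fibers n d S : weight d S (lexmon n.+2 d) =
  \sum_(0 <= j < d.+1) \sum_(w <- lexmon n j)
   (j * count (fun k => S ((d - j - k) :: k :: w)) (iota 0 (d - j).+1) +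
   \sum_(0 <= k < (d - j).+1) S ((d - j - k) :: k :: w) * k).
Proof.
rewrite /weight big_lexmonSS big_nat [RHS]big_nat; apply: eq_bigr => j /andP[_ jd].
apply: eq_bigr => w _; rewrite count_sum big_distrr.
rewrite -[X in iota 0 X]subn0 -/(index_iota 0 _) -big_split big_nat [RHS]big_nat; apply: eq_bigr => k /andP[_ kd].
rewrite /= [j * _]mulnC -mulnDr; congr (_ * _); lia.
Qed.

(** Each fiber keeps its size while its sum of exponents of [x_1] can only drop. If the total does
    not drop, every fiber is an initial segment, hence closed under trading [x_1] for [x_0]. *)
Lemma weight_compress01 n d S :
  weight d (compress01 S) (lexmon n.+2 d) <= weight d S (lexmon n.+2 d) /\
  (weight d S (lexmon n.+2 d) <= weight d (compress01 S) (lexmon n.+2 d) ->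
   forall j i k w, j <= d -> w \in lexmon n j -> i + k = d - j -> S (i :: k :: w) ->
   forall k', k' <= k -> S ((i + k - k') :: k' :: w)).
Proof.
rewrite !weight_fibers.
pose A j w := j * count (fun k => compress01 S ((d - j - k) :: k :: w)) (iota 0 (d - j).+1) +
   \sum_(0 <= k < (d - j).+1) compress01 S ((d - j - k) :: k :: w) * k.
pose B j w := j * count (fun k => S ((d - j - k) :: k :: w)) (iota 0 (d - j).+1) +
   \sum_(0 <= k < (d - j).+1) S ((d - j - k) :: k :: w) * k.
have key j w : A j w <= B j w ?= iff
   [forall k : 'I_(d - j).+1, S ((d - j - k) :: (k : nat) :: w) ==
     initial_seg (d - j) (fun k => S ((d - j - k) :: k :: w)) k].
  have [h1 h2] := sum_initial_seg_leq (d - j) (fun k => S ((d - j - k) :: k :: w)).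
  rewrite /A /B.
  have -> : count (fun k => compress01 S ((d - j - k) :: k :: w)) (iota 0 (d - j).+1) =
      count (fun k => S ((d - j - k) :: k :: w)) (iota 0 (d - j).+1).
    rewrite -[RHS]count_initial_seg; apply: eq_in_count => k; rewrite mem_iota => kd.
    by rewrite compress01E //; lia.
  have -> : \sum_(0 <= k < (d - j).+1) compress01 S ((d - j - k) :: k :: w) * k =
     \sum_(0 <= k < (d - j).+1) initial_seg (d - j) (fun k => S ((d - j - k) :: k :: w)) k * k.
    rewrite big_nat [RHS]big_nat; apply: eq_bigr => k /andP[_ kd].
    by rewrite compress01E.
  by split; rewrite ?leq_add2l ?eqn_add2l.
have keyle j w : A j w <= B j w by have [] := key j w.
split; first by apply: leq_sum => j _; apply: leq_sum => w _; exact: keyle.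
move=> le j i k w jd wj ik Sv k' k'k.
have e1 := sum_leq_eq (fun j _ => leq_sum _ (fun w _ => keyle j w)) le.
have /e1 e2 : j \in index_iota 0 d.+1 by rewrite mem_index_iota; lia.
have e3 := sum_leq_eq (fun w _ => keyle j w) (eq_leq (esym e2)) wj.
have [_ /esym] := key j w; rewrite e3 eqxx => /forallP h.
have kd : k < (d - j).+1 by lia.
have k'd : k' < (d - j).+1 by lia.
have /eqP := h (Ordinal kd); have /eqP := h (Ordinal k'd) => /=; rewrite ik => ->.
have -> : d - j - k = i by lia.
by rewrite Sv /initial_seg => /esym ?; exact: leq_ltn_trans k'k _.
Qed.

(** * Lexicographic segments minimize the shadow *)

Lemma sum_nat_delta c n x : c < n -> \sum_(0 <= j < n) x * (j == c) = x.
Proof.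
elim: n => // n IH; rewrite ltnS leq_eqVlt big_nat_recr //= => /orP[/eqP->|cn].
  rewrite eqxx muln1 big_nat big1 // => j /andP[_ jn].
  by rewrite (_ : (j == n) = false) ?muln0 //; lia.
by rewrite IH //; lia.
Qed.

Section RowArgument.
Variables (q n : nat).
Hypothesis lex_min : forall d S, d < q ->
  lexshadow q n q d (count S (lexmon n d)) <= shadow q n q d S.

(** The set above all rows contains the set above each row, and [lex_min] bounds the latter below by
    a segment; for segments the largest of these sets is the union. *)
Lemma rowshadow_le p d S : d < p -> p <= q ->
  rowshadow q n p d (fun j => count (row S d j) (lexmon n j)) <= shadow q n.+1 p d S.
Proof.
move=> dp pq; rewrite shadowS; last lia.
apply: leq_add; first by rewrite lexmon0 /= addn0 /row subn0; case: (S _).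
apply: leq_sum => i _; apply/bigmax_leqP_seq => j; rewrite mem_iota => jd ji.
apply: leq_trans (lex_min _ _) _; first lia.
apply: sub_count => a ua; apply/hasP; exists j; first by rewrite mem_iota.
by rewrite ji.
Qed.

(** When row [d.+1] is empty every element is divisible by [x_0]; dividing lowers both the degree
    and the bound [p] by one. *)
Lemma rowshadow_no_top_row p d s : s d.+1 = 0 -> 0 < p ->
  rowshadow q n p.-1 d s <= rowshadow q n p d.+1 s.
Proof.
move=> s0 p0; rewrite /rowshadow leq_add2l -{2}(prednK p0) [X in _ <= X]big_nat_recl //=.
apply: leq_trans (leq_addl _ _); apply: leq_sum => i _.
apply/bigmax_leqP_seq => j; rewrite mem_iota => jd ji.
apply: (@leq_bigmax_seq _ _ _ (fun j => lexshadow q n q j (s j))); last lia.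
by rewrite mem_iota; lia.
Qed.

Lemma lexshadow_lower p d r : d.+1 <= q -> d.+1 <= p -> r <= nmon n.+1 d ->
  lexshadow q n.+1 p d.+1 r = lexshadow q n.+1 p.-1 d r.
Proof.
move=> dq dp rd; rewrite !lexshadow_rec //; try lia.
rewrite [X in _ + X = _]big_nat_recr //= -nmonS.
have -> : r - nmon n.+1 d = 0 by lia.
by rewrite lexshadow0 addn0; congr (_ * (1 + _ * _) + _); lia.
Qed.

Lemma rowshadow_lex p d s : d < q -> (forall j, j < d -> s j = nmon n j) ->
  s d <= nmon n d ->
  lexshadow q n.+1 p d (\sum_(0 <= j < d.+1) s j) = rowshadow q n p d s.
Proof.
move=> dq sj sd; rewrite lexshadowE; last exact: ltnW.
have E : \sum_(0 <= j < d.+1) s j = psum (nmon n) d + s d.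
  rewrite big_nat_recr //=; congr (_ + _).
  by rewrite /psum big_nat [RHS]big_nat; apply: eq_bigr => j /andP[_ /sj].
rewrite E /rowshadow; congr (_ + _).
  rewrite psum0 subn0.
  case: d dq sj {sd E} => [|d] dq sj; first by rewrite psum0.
  rewrite (sj 0) // nmon0.
  have := @psum_mono (nmon n) 1 d.+1 isT; rewrite psumS nmon0 psum0; lia.
apply: eq_bigr => i _; rewrite big_seq_cond [RHS]big_seq_cond.
apply: eq_bigr => j; rewrite mem_iota add0n ltnS => /andP[/andP[_ jd] _].
case: (ltngtP j d) jd => // [jd _|-> _]; last by rewrite addKn.
rewrite (sj j) //; have := @psum_mono (nmon n) j.+1 d jd; rewrite psumS => h.
by rewrite !lexshadow_full //; lia.
Qed.

(** The slice [i = 0] of the points sees row [d] alone and loses [y]; the slice [i = d - k] gains at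
    most [y] by the exchange inequality. Slices below [d - k] do not see row [k], and those above
    are already full thanks to the complete row [k.-1]. *)
Lemma rowshadow_move p d k s x : d < p -> p <= q -> k < d ->
  (forall j, j < k -> s j = nmon n j) -> 0 < s d -> s d <= s k -> s k < nmon n k ->
  x = minn (s d) (nmon n k - s k) ->
  rowshadow q n p d
    (fun j => if j == d then s d - x else if j == k then s k + x else s j) <=
  rowshadow q n p d s.
Proof.
move=> dp pq kd full sd0 sdk sk ex; set s' := fun j => _.
have k0 : 0 < k by case: k sk sdk {s' full kd ex} => //; rewrite nmon0; lia.
have dk : k != d by lia.
have s'd : s' d = s d - x by rewrite /s' eqxx.
have s'k : s' k = s k + x by rewrite /s' eqxx (negbTE dk).
have s'j j : j != d -> j != k -> s' j = s j by rewrite /s' => /negbTE-> /negbTE->.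
rewrite /rowshadow s'j; [|lia|lia]; rewrite leq_add2l.
pose L j := lexshadow q n q j.
pose y := L d (s d) - L d (s d - x).
have yE : L d (s d - x) + y = L d (s d).
  by rewrite subnKC // lexshadow_mono // leq_subr.
have dq : d < q by lia.
have exch : L d (s d - x) + L k (s k + x) <= L d (s d) + L k (s k).
  exact: lexshadow_exchange.
have p0 : 0 < p by lia.
have ip : d - k < p by lia.
(* The amount [y] is booked at [i = 0] on the left and at [i = d - k] on the right, which allows a
   comparison slice by slice. *)
rewrite -(leq_add2r y) -{1}(sum_nat_delta y p0) -{2}(sum_nat_delta y ip) -!big_split /=.
apply: leq_sum => i _.
pose g t := \max_(j <- iota 0 d.+1 | d - j <= i) lexshadow q n q j (t j).
rewrite -/(g s) -/(g s').
have gle j : j <= d -> d - j <= i -> L j (s j) <= g s.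
  move=> jd ji; apply: (@leq_bigmax_seq _ _ _ (fun j => lexshadow q n q j (s j))) => //.
  by rewrite mem_iota; lia.
case: (posnP i) => [i0|i0].
  rewrite muln1 (_ : (i == d - k) = false) ?muln0 ?addn0; last lia.
  have <- : L d (s' d) = g s'.
    rewrite /g i0; apply/eqP; rewrite eqn_leq; apply/andP; split.
      apply: (@leq_bigmax_seq _ _ _ (fun j => lexshadow q n q j (s' j))); last lia.
      by rewrite mem_iota; lia.
    apply/bigmax_leqP_seq => j; rewrite mem_iota => jd jd'.
    by have -> : j = d by lia.
  by rewrite s'd yE; apply: gle; lia.
rewrite muln0 addn0; apply/bigmax_leqP_seq => j; rewrite mem_iota => jd ji.
case: (eqVneq j d) => [->|jnd].
  rewrite s'd; apply: leq_trans (leq_addr _ _).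
  apply: leq_trans (gle d _ _); try lia.
  by rewrite lexshadow_mono // leq_subr.
case: (eqVneq j k) => [jk|jnk]; last first.
  by rewrite s'j //; apply: leq_trans (leq_addr _ _); apply: gle; lia.
rewrite jk s'k; case: (eqVneq i (d - k)) => [ik|ik].
  have gk : L k (s k) <= g s by apply: gle; lia.
  by rewrite muln1 -/(L k _); lia.
apply: leq_trans (leq_addr _ _); apply: leq_trans (shadow_le _ _ _ _ _) _.
rewrite -(@lexshadow_full q n q k.-1 (s k.-1)); [|lia|rewrite full; lia].
by apply: gle; lia.
Qed.

End RowArgument.

(** Whether [x_1^(j - |w|) w] belongs to a segment of given size does not depend on [j]. So a
    monomial [x_1^k w] missing from row [j] but within its first [s d] monomials has a counterpart
    [x_1^(d - |w|) w] in row [d], which stability under compression brings back to row [j]. *)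
Lemma rowlex_stable n d s : (forall j, j <= d -> s j <= nmon n.+1 j) ->
  weight d (rowlex n.+1 d s) (lexmon n.+2 d) <=
    weight d (compress01 (rowlex n.+1 d s)) (lexmon n.+2 d) ->
  forall j, j <= d -> minn (s d) (nmon n.+1 j) <= s j.
Proof.
move=> sn le j jd; have [_ /(_ le) stable] := weight_compress01 n d (rowlex n.+1 d s).
set m := minn _ _; rewrite leqNgt; apply/negP => mj.
have : ~~ all (fun v => lexseg n.+1 j m v ==> lexseg n.+1 j (s j) v) (lexmon n.+1 j).
  apply/negP => /allP al; move: mj; apply/negP; rewrite -leqNgt.
  have := lexseg_count n.+1 j (s j); have := lexseg_count n.+1 j m.
  have -> : minn m (nmon n.+1 j) = m by rewrite /m; lia.
  have -> : minn (s j) (nmon n.+1 j) = s j by have := sn j jd; lia.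
  move=> <- <-; rewrite -!size_filter; apply: uniq_leq_size.
    by rewrite filter_uniq // lexmon_uniq.
  by move=> v; rewrite !mem_filter => /andP[h vj]; rewrite vj andbT; have := al v vj; rewrite h.
rewrite -has_predC => /hasP[v vj] /=; rewrite negb_imply => /andP[vm vnj].
move: vj vm vnj; rewrite mem_lexmon; case: v => [|k w] //=; rewrite eqSS.
move=> /andP[sw /eqP nw].
have kE : k = j - sumn w by lia.
have wj : sumn w <= j by lia.
rewrite {1 2}kE !lexseg_row // => vm /negP; apply.
have top : rowlex n.+1 d s (0 :: (d - sumn w) :: w).
  rewrite /= subn0 lexseg_row; last lia.
  by apply: lexseg_mono vm; rewrite leq_sub2r // /m geq_minl.
have := stable (sumn w) 0 (d - sumn w) w _ _ _ top (j - sumn w).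
rewrite add0n (_ : d - sumn w - (j - sumn w) = d - j); last lia.
rewrite /= subKn // lexseg_row //; apply; rewrite ?leq_sub2r //; first lia.
by rewrite mem_lexmon sw eqxx.
Qed.

(** Induction on [d] and, for fixed [d], on the weight of the family of rows. *)
Lemma rowshadow_min q n :
  (forall d S, d < q ->
    lexshadow q n q d (count S (lexmon n d)) <= shadow q n q d S) ->
  forall d p s, d < p -> p <= q -> (forall j, j <= d -> s j <= nmon n j) ->
  lexshadow q n.+1 p d (\sum_(0 <= j < d.+1) s j) <= rowshadow q n p d s.
Proof.
case: n => [|n] lex_min.
  move=> d p s dp pq sn; rewrite lexshadow_rec; [|lia|lia].
  rewrite -[size _]/0 muln0 addn0 muln1 [X in _ + X]big1 // addn0; apply: leq_trans (leq_addr _ _).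
  rewrite big_nat_recl // big_nat big1 ?addn0 // => j /andP[_ jd].
  by have := sn j.+1 jd; rewrite leqn0 => /eqP.
elim=> [|d IHd] p s dp pq sn.
  by rewrite rowshadow_lex //; [lia|exact: sn].
have [N] := ubnP (\sum_(0 <= j < d.+2) j * s j).
elim: N s sn => // N IH s sn sN.
(* If all elements are divisible by [x_0], the induction on [d] applies. *)
case: (posnP (s d.+1)) => [s0|s0].
  apply: leq_trans (rowshadow_no_top_row _ _ s0 _); last lia.
  rewrite big_nat_recr //= s0 addn0 lexshadow_lower; [|lia|lia|].
    by apply: IHd => [||j jd]; [lia|lia|apply: sn; lia].
  rewrite nmonS /psum big_nat [X in _ <= X]big_nat; apply: leq_sum => j /andP[_ jd].
  by apply: sn; lia.
set S := rowlex n.+1 d.+1 s.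
have wS : weight d.+1 S (lexmon n.+2 d.+1) = \sum_(0 <= j < d.+2) j * s j.
  rewrite weight_rows big_nat [RHS]big_nat; apply: eq_bigr => j /andP[_ jd].
  rewrite (eq_count (a2 := lexseg n.+1 j (s j))); last by move=> v; rewrite row_rowlex.
  by rewrite lexseg_count; congr (_ * _); apply/minn_idPl/sn.
have dq : d.+1 <= q by lia.
(* If compression lowers the weight, the rows of the compressed set are made segments again and the
   inner induction applies. *)
case: (ltnP (weight d.+1 (compress01 S) (lexmon n.+2 d.+1)) (weight d.+1 S (lexmon n.+2 d.+1))) => wt.
  rewrite -shadow_rowlex // -/S; apply: leq_trans (shadow_compress01 _ _ dp pq).
  apply: leq_trans (rowshadow_le lex_min _ dp pq).
  rewrite -(rowlex_count sn) -/S -count_compress01 count_lexmonS.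
  apply: IH => [j jd|]; first exact: count_size.
  by rewrite -weight_rows; lia.
have st := rowlex_stable sn wt.
(* In the stable case, either all rows before the last are complete and [S] is a segment, or
   elements of the last row move to the first incomplete one. *)
case: (boolP [exists j : 'I_d.+1, s j < nmon n.+1 j]) => [/existsP[j0 hj0]|]; last first.
  rewrite negb_exists => /forallP h; rewrite rowshadow_lex //; [lia| |exact: sn].
  move=> j jd; have := h (Ordinal jd); rewrite -leqNgt /= => h1.
  by apply/eqP; rewrite eqn_leq h1 sn // ltnW.
have ex : exists j, (s j < nmon n.+1 j) && (j < d.+1) by exists j0; rewrite hj0 ltn_ord.
case: (ex_minnP ex) => k /andP[sk kd] kmin.
have full j : j < k -> s j = nmon n.+1 j.
  move=> jk; apply/eqP; rewrite eqn_leq sn; last lia.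
  by rewrite leqNgt; apply/negP => h; have := kmin j; rewrite h /=; lia.
have sdk : s d.+1 <= s k by have := st k (ltnW kd); lia.
set x := minn (s d.+1) (nmon n.+1 k - s k).
pose s' j := if j == d.+1 then s d.+1 - x else if j == k then s k + x else s j.
apply: leq_trans (rowshadow_move dp pq kd full s0 sdk sk (erefl x) : rowshadow _ _ _ _ s' <= _).
have s'E j : s' j + x * (j == d.+1) = s j + x * (j == k).
  rewrite /s'; case: (eqVneq j d.+1) => [->|jd].
    by rewrite (_ : (d.+1 == k) = false); lia.
  by case: eqVneq => [->|]; lia.
have sumE : \sum_(0 <= j < d.+2) s' j = \sum_(0 <= j < d.+2) s j.
  apply/eqP; rewrite -(eqn_add2r x) -{1}(@sum_nat_delta d.+1 d.+2 x) //.
  rewrite -{2}(@sum_nat_delta k d.+2 x); last lia.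
  by rewrite -!big_split /=; apply/eqP; apply: eq_bigr => j _; exact: s'E.
rewrite -sumE; apply: IH => [j jd|].
  rewrite /s'; case: eqP => [->|_]; first by rewrite (leq_trans (leq_subr _ _)) // sn.
  by case: eqP => [->|_]; [rewrite /x; lia|exact: sn].
have : \sum_(0 <= j < d.+2) j * s' j + x * d.+1 = \sum_(0 <= j < d.+2) j * s j + x * k.
  rewrite -(@sum_nat_delta d.+1 d.+2 (x * d.+1)) // -(@sum_nat_delta k d.+2 (x * k)); last lia.
  rewrite -!big_split; apply: eq_bigr => j _ /=; have := s'E j.
  by case: (eqVneq j d.+1) => [->|_]; case: eqVneq => [->|_]; nia.
have x0 : 0 < x by rewrite /x; lia.
nia.
Qed.

(** The bound [p] is separate from [q] because division by [x_0] lowers it; fewer variables enter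
    with [p = q] only. *)
Theorem lexshadow_min q n p d S : d < p -> p <= q ->
  lexshadow q n p d (count S (lexmon n d)) <= shadow q n p d S.
Proof.
elim: n p d S => [|n IH] p d S dp pq //.
apply: leq_trans (rowshadow_le _ _ dp pq).
  rewrite count_lexmonS; apply: rowshadow_min => //; last by move=> j _; exact: count_size.
  by move=> k R kq; exact: IH.
by move=> k R kq; exact: IH.
Qed.

(** * Reduced monomials of large degree *)

Fixpoint reduced (q : nat) (v : seq nat) : bool :=
  if v is i :: a then ((sumn a == 0) || (i < q)) && reduced q a else true.

(* The reduced monomials of degree [e], provided that [n * q < e]. *)
Fixpoint redmon (q n e : nat) : seq (seq nat) :=
  if n is n'.+1 then
    (e :: nseq n' 0) ::
      flatten [seq [seq i :: a | a <- redmon q n' (e - i)] | i <- rev (iota 0 q)]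
  else [::].

Lemma reduced_nseq0 q n : reduced q (nseq n 0).
Proof. by elim: n => //= n ->; rewrite sumn_nseq0. Qed.

Lemma sumn_eq0 (a : seq nat) : sumn a = 0 -> a = nseq (size a) 0.
Proof. by elim: a => //= x a IH /eqP; rewrite addn_eq0 => /andP[/eqP-> /eqP/IH <-]. Qed.

Lemma mem_redmon q n e v : n * q < e ->
  (v \in redmon q n e) = [&& size v == n, sumn v == e & reduced q v].
Proof.
elim: n e v => [|n IH] e v ne; first by case: v => //=; case: e ne.
rewrite inE; apply/orP/and3P => [[/eqP->|]|[sv nv rv]].
- by rewrite /= size_nseq sumn_nseq0 addn0 reduced_nseq0.
- move=> /flatten_mapP[i]; rewrite mem_rev mem_iota => iq /mapP[a ap ->].
  have ne' : n * q < e - i by move: ne; rewrite mulSn; lia.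
  move: ap; rewrite IH // => /and3P[/eqP sa /eqP na ra] /=.
  rewrite sa na ra !eqxx andbT; split=> //; first lia.
  by apply/orP; right; lia.
- case: v sv nv rv => [|i a] //=; rewrite eqSS => /eqP sa /eqP na /andP[/orP[/eqP a0|iq] ra].
    by left; move: na; rewrite a0 addn0 => <-; rewrite -sa -sumn_eq0.
  right; apply/flatten_mapP; exists i; first by rewrite mem_rev mem_iota; lia.
  apply/mapP; exists a => //; rewrite IH; first by rewrite sa ra eqxx; lia.
  by move: ne; rewrite mulSn; lia.
Qed.

Lemma redmon_uniq q n e : n * q < e -> uniq (redmon q n e).
Proof.
elim: n e => [|n IH] e ne //.
rewrite -[redmon q n.+1 e]/((e :: nseq n 0) ::
  flatten [seq [seq i :: a | a <- redmon q n (e - i)] | i <- rev (iota 0 q)]) cons_uniq.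
apply/andP; split.
  apply/negP => /flatten_mapP[i]; rewrite mem_rev mem_iota => iq /mapP[a _ [ei _]].
  by move: ne; rewrite mulSn; lia.
have gen p : p <= q ->
    uniq (flatten [seq [seq i :: a | a <- redmon q n (e - i)] | i <- rev (iota 0 p)]).
  elim: p => [|p IHp] // pq.
  rewrite rev_iotaS map_cons [flatten _]/= cat_uniq IHp ?andbT; last lia.
  rewrite map_inj_uniq; last by move=> x y [].
  rewrite IH /=; last by move: ne; rewrite mulSn; lia.
  apply/hasPn => v /flatten_mapP[i]; rewrite mem_rev mem_iota => ip /mapP[a _ ->].
  by apply/mapP => -[b _ [e' _]]; lia.
exact: gen.
Qed.

(** Both lists follow the same recursion, and truncating exponents at [q] turns the first into the
    second. *)
Lemma count_redmon q n e (P : pred (seq nat)) : n * q < e ->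
  (forall a, P a = P [seq minn q x | x <- a]) ->
  count P (redmon q n e) = count P (points q n q).
Proof.
elim: n e P => [|n IH] e P ne sat //.
rewrite count_points -[redmon q n.+1 e]/((e :: nseq n 0) ::
  flatten [seq [seq i :: a | a <- redmon q n (e - i)] | i <- rev (iota 0 q)]).
rewrite -[count _ (_ :: _)]/(P _ + count P _).
rewrite [count P (flatten _)]count_sum big_flatten big_map big_rev /index_iota subn0.
congr (_ + _).
  congr nat_of_bool; rewrite sat [RHS]sat /= minnn; congr (P (_ :: _)).
  by apply/minn_idPl; move: ne; rewrite mulSn; lia.
rewrite big_seq [RHS]big_seq; apply: eq_bigr => i; rewrite mem_iota => /andP[_ iq].
rewrite big_map -count_sum -(IH (e - i) (fun a => P (i :: a))) //.
  by move: ne; rewrite mulSn; lia.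
move=> a; rewrite sat [RHS]sat /=; congr (P (_ :: _)).
by rewrite -map_comp; apply: eq_map => x /=; lia.
Qed.

Lemma upset_saturated q n d S a : d <= q ->
  upset n d S a = upset n d S [seq minn q x | x <- a].
Proof.
move=> dq; apply: eq_in_has => v; rewrite mem_lexmon => /andP[_ /eqP nv].
congr (_ && _); have {nv} : sumn v <= q by rewrite nv.
elim: v a => [|x v IH] [|y a] //= h; rewrite -IH; last lia.
by congr (_ && _); lia.
Qed.

(** * Lexicographic order on exponent lists *)

Fixpoint slexlt (b a : seq nat) : bool :=
  match b, a with
  | x :: b', y :: a' => (x < y) || (x == y) && slexlt b' a'
  | _, _ => false
  end.

Lemma slexlt_irr a : slexlt a a = false.
Proof. by elim: a => //= x a ->; rewrite ltnn andbF. Qed.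

Lemma slexlt_asym a b : slexlt a b -> slexlt b a = false.
Proof.
elim: a b => [|x a IH] [|y b] //= /orP[xy|/andP[/eqP-> /IH ->]]; first by lia.
by rewrite ltnn andbF.
Qed.

Lemma lexmon_sorted n d : pairwise (fun a b => slexlt b a) (lexmon n d).
Proof.
elim: n d => [|n IH] d; first by case: d.
rewrite lexmonS.
have gen m j0 : j0 + m <= d.+1 -> pairwise (fun a b => slexlt b a)
    (flatten [seq [seq (d - j) :: v | v <- lexmon n j] | j <- iota j0 m]).
  elim: m j0 => [|m IHm] j0 // jm.
  rewrite -[iota _ m.+1]/(j0 :: iota j0.+1 m) map_cons [flatten _]/= pairwise_cat.
  rewrite IHm ?addSnnS // andbT; apply/andP; split.
    apply/allrelP => x y /mapP[v _ ->] /flatten_mapP[j]; rewrite mem_iota => jj /mapP[w _ ->] /=.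
    by apply/orP; left; lia.
  rewrite pairwise_map; apply: sub_pairwise (IH j0) => x y /= ->.
  by rewrite eqxx orbT.
exact: gen.
Qed.

(** This identifies [Mfirst], defined by counting the elements above, with the first [r] entries of
    a sorted list. *)
Lemma count_above_index (T : eqType) (R : rel T) (l : seq T) (x : T) :
  irreflexive R -> (forall a b, R a b -> R b a = false) ->
  pairwise R l -> x \in l -> count (fun y => R y x) l = index x l.
Proof.
move=> irr asym; elim: l => //= y l IH /andP[/allP ay pl].
rewrite inE eq_sym; case: eqVneq => [<- _|_ /= xl]; last by rewrite ay // IH.
rewrite irr add0n; apply/eqP; rewrite -leqn0 leqNgt -has_count.
by apply/hasPn => z /ay /asym ->.
Qed.

Lemma nmonE n d : nmon n.+1 d = 'C(n + d, d).
Proof.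
elim: n d => [|n IH] d; first by rewrite nmon1 add0n binn.
elim: d => [|d IHd]; first by rewrite nmon0 bin0.
rewrite nmonS psumS -nmonS IHd IH -[n + d.+1]addSnnS [n.+1 + d.+1]addnS binS.
exact: addnC.
Qed.

(** * From finite sets of monomials to lists *)

Definition exps (m e : nat) (a : mono m e) : seq nat := [seq (a i : nat) | i <- enum 'I_m.+1].

Lemma size_exps m e (a : mono m e) : size (exps a) = m.+1.
Proof. by rewrite size_map size_enum_ord. Qed.

Lemma nth_exps m e (a : mono m e) (i : 'I_m.+1) : nth 0 (exps a) i = a i.
Proof. by rewrite (nth_map ord0) ?size_enum_ord // nth_ord_enum. Qed.

Lemma sumn_exps m e (a : mono m e) : sumn (exps a) = mdegree a.
Proof. by rewrite sumnE big_map /mdegree big_enum. Qed.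

Lemma exps_inj m e : injective (@exps m e).
Proof. by move=> a b h; apply/ffunP => i; apply: val_inj; rewrite /= -!nth_exps h. Qed.

Lemma leq_nth_sumn (v : seq nat) i : nth 0 v i <= sumn v.
Proof. by elim: v i => [|x v IH] [|i] //=; [rewrite leq_addr|have := IH i; lia]. Qed.

Lemma exps_surj m e v : size v = m.+1 -> sumn v <= e -> exists a : mono m e, exps a = v.
Proof.
move=> sv nv; exists [ffun i : 'I_m.+1 => inord (nth 0 v i)].
apply: (@eq_from_nth _ 0); rewrite size_exps // => i im.
rewrite -[i]/(nat_of_ord (Ordinal im)) nth_exps ffunE inordK // ltnS.
exact: leq_trans (leq_nth_sumn _ _) nv.
Qed.

Lemma reducedP q v : reflect
  (forall i j, i < j -> j < size v -> 0 < nth 0 v j -> nth 0 v i < q) (reduced q v).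
Proof.
apply: (iffP idP).
  elim: v => //= x v IH /andP[h rv] [|i] [|j] //=; last by rewrite !ltnS; exact: IH.
  move=> _ jv vj; case/orP: h => // /eqP v0.
  by have := leq_nth_sumn v j; rewrite v0; lia.
elim: v => //= x v IH h; rewrite IH ?andbT; last first.
  by move=> i j ij jv; exact: (h i.+1 j.+1).
case: eqP => //= /eqP; rewrite -lt0n => v0.
have [j jv vj] : exists2 j, j < size v & 0 < nth 0 v j.
  have : has (fun y => 0 < y) v.
    elim: v v0 {IH h} => //= y v IH; case: y => //=; exact: IH.
  by move=> /(has_nthP 0)[j jv vj]; exists j.
exact: (h 0 j.+1).
Qed.

Lemma proj_reduced_exps q m e (a : mono m e) : 0 < q ->
  proj_reduced q (fun i => (a i : nat)) = reduced q (exps a).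
Proof.
move=> q0; apply/forallP/reducedP => [h i j ij|h i].
  rewrite size_exps => jm aj; have im := ltn_trans ij jm.
  have /forallP/(_ (Ordinal jm)) := h (Ordinal im).
  rewrite -!nth_exps ij aj /=; lia.
apply/forallP => j; apply/implyP; rewrite -!nth_exps => /andP[ij aj].
by have := h i j ij; rewrite size_exps ltn_ord => /(_ isT aj); lia.
Qed.

Lemma mdivides_exps m d e (a : mono m d) (b : mono m e) :
  mdivides a b = all2 leq (exps a) (exps b).
Proof.
have -> : all2 leq (exps a) (exps b) = all (fun i : 'I_m.+1 => a i <= b i) (enum 'I_m.+1).
  by rewrite /exps; elim: (enum _) => //= i s ->.
apply/forallP/allP => [h i _|h i]; first exact: h.
by apply: h; rewrite mem_enum.
Qed.

Lemma slexltP s t : size s = size t -> reflect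
  (exists2 i, i < size s & (forall j, j < i -> nth 0 s j = nth 0 t j) /\ nth 0 s i < nth 0 t i)
  (slexlt s t).
Proof.
move=> st; apply: (iffP idP).
  elim: s t st => [|x s IH] [|y t] //= [st] /orP[xy|/andP[/eqP <- h]].
    by exists 0 => //; split.
  have [i is_ [h1 h2]] := IH _ st h; exists i.+1 => //; split=> // -[|j] //=.
  exact: h1.
elim: s t st => [|x s IH] [|y t] //; first by move=> _ [].
move=> /= [st] [[|i] /= is_ [h1 h2]]; first by rewrite h2.
have /= -> := h1 0 isT; rewrite eqxx; apply/orP; right; apply: IH => //; exists i => //; split=> // j ji.
exact: (h1 j.+1).
Qed.

Lemma lexlt_exps m d (a b : mono m d) :
  lexlt (fun i => (a i : nat)) (fun i => (b i : nat)) = slexlt (exps a) (exps b).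
Proof.
apply/existsP/slexltP; rewrite ?size_exps //.
  move=> [i /andP[/forallP h1 h2]]; exists i; rewrite ?size_exps // !nth_exps; split=> // j ji.
  have jm := ltn_trans ji (ltn_ord i).
  have /implyP/(_ ji)/eqP := h1 (Ordinal jm); by rewrite -!nth_exps.
move=> [i im [h1 h2]]; exists (Ordinal im); rewrite -!nth_exps /= h2 andbT.
by apply/forallP => j; apply/implyP => ji; rewrite -!nth_exps h1.
Qed.

Definition spred (m d : nat) (S : {set mono m d}) : pred (seq nat) :=
  fun v => v \in [seq exps a | a <- enum S].

Lemma spred_exps m d (S : {set mono m d}) a : spred S (exps a) = (a \in S).
Proof. by rewrite /spred mem_map ?mem_enum //; exact: exps_inj. Qed.

Lemma count_mem_uniq (T : eqType) (l1 l2 : seq T) : uniq l1 -> uniq l2 ->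
  {subset l1 <= l2} -> count (fun x => x \in l1) l2 = size l1.
Proof.
move=> u1 u2 sub; rewrite -size_filter; apply/perm_size/uniq_perm => //.
  exact: filter_uniq.
by move=> x; rewrite mem_filter; case: (boolP (x \in l1)) => // /sub ->.
Qed.

Section Bridge.
Variables (q m : nat).
Hypothesis q0 : 0 < q.

Lemma mem_Mbar_large e (a : mono m e) : m.+1 * q < e ->
  (a \in Mbar q m e) = (exps a \in redmon q m.+1 e).
Proof.
by move=> ne; rewrite inE mem_redmon // size_exps eqxx sumn_exps proj_reduced_exps.
Qed.

(** A positive later exponent leaves at most [d - 1 < q] for an earlier one, so every monomial of
    degree [d <= q] is reduced. *)
Lemma Mbar_small d (a : mono m d) : d <= q -> (a \in Mbar q m d) = (exps a \in lexmon m.+1 d).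
Proof.
move=> dq; rewrite inE mem_lexmon size_exps eqxx sumn_exps /=.
case: eqP => //= ad; rewrite proj_reduced_exps //; apply/reducedP => i j ij jm aj.
have : nth 0 (exps a) i + nth 0 (exps a) j <= d.
  rewrite -[X in _ <= X]ad -sumn_exps {aj ad dq jm}; move: (exps a) => v.
  elim: v i j ij => [|x v IH] [|i] [|j] //= ij; first by rewrite leq_add2l leq_nth_sumn.
  by have := IH i j ij; lia.
by lia.
Qed.

Lemma card_nabla d e (S : {set mono m d}) : d <= q -> m.+1 * q < e ->
  S \subset Mbar q m d -> #|nabla q e S| = shadow q m.+1 q d (spred S).
Proof.
move=> dq ne SM; rewrite /shadow -(count_redmon ne); last by move=> a; exact: upset_saturated.
rewrite cardE -(size_map (@exps m e)) -size_filter; apply/perm_size/uniq_perm.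
- by rewrite map_inj_uniq ?enum_uniq //; exact: exps_inj.
- by rewrite filter_uniq // redmon_uniq.
have key (a : mono m e) : (a \in nabla q e S) =
    upset m.+1 d (spred S) (exps a) && (exps a \in redmon q m.+1 e).
  rewrite inE mem_Mbar_large // andbC; congr (_ && _).
  apply/existsP/hasP => [[b /andP[bS ba]]|[v vd /andP[/mapP[b bS vb] va]]].
    exists (exps b); first by rewrite -Mbar_small // (subsetP SM).
    by rewrite spred_exps bS -mdivides_exps.
  by exists b; rewrite mdivides_exps -vb va andbT -mem_enum.
move=> v; apply/mapP/idP => [[a aM ->]|].
  by rewrite mem_filter -key -mem_enum.
rewrite mem_filter => /andP[uv ve]; move: (ve); rewrite mem_redmon // => /and3P[/eqP sv /eqP nv _].
have [a av] := @exps_surj m e v sv (eq_leq nv).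
by exists a; rewrite // mem_enum key av uv.
Qed.

Lemma count_spred d (S : {set mono m d}) : d <= q -> S \subset Mbar q m d ->
  count (spred S) (lexmon m.+1 d) = #|S|.
Proof.
move=> dq SM; rewrite count_mem_uniq ?lexmon_uniq ?map_inj_uniq ?enum_uniq //.
- by rewrite size_map -cardE.
- exact: exps_inj.
by move=> v /mapP[a aS ->]; rewrite -Mbar_small // (subsetP SM) // -mem_enum.
Qed.

Lemma Mfirst_sub d r : Mfirst q m d r \subset Mbar q m d.
Proof. by apply/subsetP => a; rewrite inE => /andP[]. Qed.

Lemma spred_Mfirst d r : d <= q ->
  {in lexmon m.+1 d, spred (Mfirst q m d r) =1 lexseg m.+1 d r}.
Proof.
move=> dq v vn.
have /andP[/eqP sv /eqP nv] : (size v == m.+1) && (sumn v == d) by rewrite -mem_lexmon.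
have [a av] := @exps_surj m d v sv (eq_leq nv).
rewrite -av spred_exps inE Mbar_small // av vn /=.
rewrite /lexseg in_take //; congr (_ < r).
have srt := lexmon_sorted m.+1 d.
have := @count_above_index _ (fun a b => slexlt b a) _ v _ _ srt vn => <-; last 2 first.
- by move=> x; exact: slexlt_irr.
- by move=> x y; exact: slexlt_asym.
rewrite cardE -(size_map (@exps m d)) -size_filter; apply/perm_size/uniq_perm.
- by rewrite map_inj_uniq ?enum_uniq //; exact: exps_inj.
- by rewrite filter_uniq // lexmon_uniq.
move=> w; apply/mapP/idP => [[b]|].
  rewrite mem_enum inE lexlt_exps Mbar_small // av => /andP[bn ab] ->.
  by rewrite mem_filter bn andbT.
rewrite mem_filter => /andP[vw wn].
have /andP[/eqP sw /eqP nw] : (size w == m.+1) && (sumn w == d) by rewrite -mem_lexmon.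
have [b bw] := @exps_surj m d w sw (eq_leq nw).
by exists b; rewrite // mem_enum inE lexlt_exps Mbar_small // bw av vw wn.
Qed.

Lemma card_Mfirst d r : d <= q -> r <= 'C(m + d, d) -> #|Mfirst q m d r| = r.
Proof.
move=> dq rC; rewrite -count_spred ?Mfirst_sub // (eq_in_count (spred_Mfirst r dq)).
by rewrite lexseg_count; apply/minn_idPl; rewrite nmonE.
Qed.

Lemma Delta_Mfirst_max d e (S : {set mono m d}) : d < q -> m.+1 * q < e ->
  S \subset Mbar q m d -> #|Delta q e S| <= #|Delta q e (Mfirst q m d #|S|)|.
Proof.
move=> dq ne SM; have dq' := ltnW dq.
have sub T : nabla (d := d) q e T \subset Mbar q m e.
  by apply/subsetP => a; rewrite inE => /andP[].
rewrite /Delta !cardsD !(setIidPr (sub _)) leq_sub2l //.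
rewrite !card_nabla ?Mfirst_sub // (eq_shadow _ _ (spred_Mfirst _ dq')).
by rewrite -(count_spred dq' SM); exact: lexshadow_min.
Qed.

End Bridge.

(** * The projective footprint bound *)

Import GRing.Theory.
Local Open Scope ring_scope.

(** Used both for the functional on the common zeros and for counting leading monomials. *)
Lemma exists_left_kernel (F : fieldType) (I J : finType) (A : {set I}) (B : {set J})
    (M : I -> J -> F) : (#|B| < #|A|)%N ->
  exists c : I -> F, (exists2 i, i \in A & c i != 0) /\
    forall j, j \in B -> \sum_(i in A) c i * M i j = 0.
Proof.
move=> BA; pose X := \matrix_(i < #|A|, j < #|B|) M (enum_val i) (enum_val j).
have : kermx X != 0.
  rewrite kermx_eq0; apply/negP => /eqP e; have := rank_leq_col X.
  by rewrite e leqNgt BA.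
move=> /rowV0Pn[v /sub_kermxP vX v0].
pose c i := \sum_(k < #|A| | enum_val k == i) v 0 k.
have cE k : c (enum_val k) = v 0 k.
  rewrite /c (big_pred1 k) // => k' /=; apply/eqP/eqP => [|-> //]; exact: enum_val_inj.
exists c; split.
  have [k vk] : exists k, v 0 k != 0.
    apply/existsP; rewrite -negb_forall; apply: contra v0 => /forallP h.
    by apply/eqP/rowP => k; rewrite mxE; apply/eqP.
  by exists (enum_val k); rewrite ?enum_valP ?cE.
move=> j jB; rewrite big_enum_val /=.
move/matrixP/(_ 0 (enum_rank_in jB j)): vX; rewrite !mxE => e0.
rewrite -[RHS]e0; apply: eq_bigr => k _; by rewrite cE !mxE enum_rankK_in.
Qed.

Section Footprint.
Variables (F : finFieldType) (m : nat).
Local Notation q := #|F|.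
Local Notation point := {ffun 'I_m.+1 -> F}.
Local Notation poly := {mpoly F[m.+1]}.

Lemma field_card_gt1 : (1 < q)%N. Proof. exact: finRing_gt1. Qed.

Lemma expf_card_pred (x : F) : x != 0 -> x ^+ q.-1 = 1.
Proof.
move=> x0; apply: (mulIf x0); rewrite mul1r -exprSr prednK ?expf_card //.
exact: ltnW field_card_gt1.
Qed.

Definition mnm_of (e : nat) (a : mono m e) : 'X_{1..m.+1} := [multinom (a i : nat) | i < m.+1].

Lemma mdeg_mnm_of e (a : mono m e) : mdeg (mnm_of a) = mdegree a.
Proof. by rewrite mdegE /mdegree; apply: eq_bigr => i _; rewrite mnmE. Qed.

Lemma mnm_of_surj e (k : 'X_{1..m.+1}) : mdeg k = e -> exists a : mono m e, mnm_of a = k.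
Proof.
move=> ke; exists [ffun i => inord (k i)]; apply/mnmP => i.
rewrite mnmE ffunE inordK // ltnS -ke mdegE (bigD1 i) //=; exact: leq_addr.
Qed.

Lemma homog_prod (I : Type) (s : seq I) (P : I -> poly) d :
  (forall i, P i \is d.-homog) -> \prod_(i <- s) P i \is (size s * d).-homog.
Proof.
move=> h; elim: s => [|i s IH]; first by rewrite big_nil dhomog1.
by rewrite big_cons mulSn; apply: dhomogM.
Qed.

(* A form of degree [e] whose value at normalized points is the indicator of
   the point [z], whose first nonzero coordinate has index [i]. *)
Definition indicator_form (e : nat) (z : point) (i : 'I_m.+1) : poly :=
  'X_i ^+ (e - m.+1 * q.-1) *
  \prod_(j <- enum 'I_m.+1) ('X_i ^+ q.-1 - ('X_j - z j *: 'X_i) ^+ q.-1).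

Lemma indicator_form_homog e z i : (m.+1 * q.-1 <= e)%N ->
  indicator_form e z i \is e.-homog.
Proof.
move=> le; have X1 j : ('X_j : poly) \is 1.-homog by rewrite dhomogX /= mdeg1.
have Xn p k : (p : poly) \is 1.-homog -> p ^+ k \is k.-homog.
  by move=> hp; have := dhomogMn k hp; rewrite mul1n.
rewrite -{2}(subnK le) /indicator_form; apply: dhomogM; first exact: Xn.
have -> : (m.+1 * q.-1 = size (enum 'I_m.+1) * q.-1)%N by rewrite size_enum_ord.
apply: homog_prod => j.
apply: rpredB; first exact: Xn.
by apply: Xn; apply: rpredB => //; apply: rpredZ.
Qed.

Lemma indicator_form_eval e z i (x : point) : (indicator_form e z i).@[x] =
  x i ^+ (e - m.+1 * q.-1) *
  \prod_(j <- enum 'I_m.+1) (x i ^+ q.-1 - (x j - z j * x i) ^+ q.-1).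
Proof.
rewrite /indicator_form rmorphM rmorphXn /= mevalXU rmorph_prod /=; congr (_ * _).
apply: eq_bigr => j _.
by rewrite rmorphB !rmorphXn rmorphB /= !mevalXU mevalZ mevalXU.
Qed.

(** The positive power of ['X_i] kills the points with [x i = 0]. Otherwise nonzero elements have
    [q.-1]-th power 1, so a factor vanishes as soon as [x j != z j * x i]; proportional normalized
    points coincide. *)
Lemma indicator_formP e (z x : point) (i : 'I_m.+1) : (m.+1 * q.-1 < e)%N ->
  z i = 1 -> (forall j : 'I_m.+1, (j < i)%N -> z j = 0) -> proj_point x ->
  (indicator_form e z i).@[x] = (x == z)%:R.
Proof.
move=> le zi zlt xp; rewrite indicator_form_eval.
have q1 : (0 < q.-1)%N by have := field_card_gt1; lia.
case: eqP => [->|xz].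
  rewrite zi expr1n mul1r big1 // => j _.
  by rewrite mulr1 subrr expr0n expr1n eqn0Ngt q1 subr0.
apply/eqP/negPn/negP; rewrite mulf_eq0 negb_or => /andP[h1 h2]; apply: xz.
have xi : x i != 0.
  by apply: contra h1 => /eqP->; rewrite expr0n subn_eq0 leqNgt le.
have h3 j : x j = z j * x i.
  apply/eqP; rewrite -subr_eq0; apply: contraTT h2 => h4.
  rewrite negbK (big_rem j) ?mem_enum //=.
  by rewrite (expf_card_pred xi) (expf_card_pred h4) subrr mul0r.
have /existsP[k /andP[/eqP xk /forallP xlt]] := xp.
suff ki : k = i by apply/ffunP => j; rewrite h3 -[in x i]ki xk mulr1.
apply: val_inj; case: (ltngtP k i) => // ki.
  by move: xk; rewrite h3 zlt // mul0r => /esym/eqP; rewrite oner_eq0.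
by move: xi; have /implyP/(_ ki)/eqP -> := xlt i; rewrite eqxx.
Qed.

Section Functional.
Variables (Z : {set point}) (c : point -> F).

Definition Lambda (p : poly) : F := \sum_(z in Z) c z * p.@[z].

Lemma Lambda_sum (I : Type) (s : seq I) (a : I -> F) (P : I -> poly) :
  Lambda (\sum_(i <- s) a i *: P i) = \sum_(i <- s) a i * Lambda (P i).
Proof.
rewrite /Lambda; under [RHS]eq_bigr do rewrite big_distrr /=.
rewrite exchange_big /=; apply: eq_bigr => z _.
rewrite raddf_sum big_distrr /=; apply: eq_bigr => i _.
by rewrite mevalZ !mulrA (mulrC (c z)).
Qed.

Lemma Lambda_homog e p : (forall k, mdeg k = e -> Lambda 'X_[k] = 0) ->
  p \is e.-homog -> Lambda p = 0.
Proof.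
move=> h /dhomogP hp; rewrite [p]mpolyE Lambda_sum big_seq big1 // => k kp.
by rewrite h ?mulr0 //; exact: hp.
Qed.

(** Over [F] the monomials [x_i^q x_j] and [x_i x_j^q] take the same values, and for [i < j] the
    second is the smaller one. *)
Lemma reduction_step (k : 'X_{1..m.+1}) :
  ~~ proj_reduced q (fun i => k i) ->
  exists k' : 'X_{1..m.+1}, [/\ mdeg k' = mdeg k, (k' < k)%O &
    Lambda 'X_[k'] = Lambda 'X_[k]].
Proof.
rewrite negb_forall => /existsP[i]; rewrite negb_forall => /existsP[j].
rewrite negb_imply -ltnNge => /andP[/andP[ij kj] ki].
have q1 := field_card_gt1.
pose a := (U_(i) *+ q + U_(j))%MM; pose b := (U_(i) + U_(j) *+ q)%MM.
have nij : (i == j) = false by apply/negbTE; rewrite neq_ltn ij.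
have ak : (a <= k)%MM.
  apply/mnm_lepP => l; rewrite mnmDE mulmnE !mnm1E.
  by case: (eqVneq i l) => [<-|_]; [rewrite eq_sym nij|case: eqP => [<-|_]]; lia.
have ab : mdeg b = mdeg a by rewrite !mdegD !mdegMn !mdeg1; lia.
exists (k - a + b)%MM; split.
- by rewrite mdegD ab -mdegD submK.
- rewrite -{2}(submK ak) ltmc_add2r; apply/ltmcP => //; exists i => [l li|].
    rewrite !mnmDE !mulmnE !mnm1E.
    have -> : (i == l) = false by apply/negbTE; rewrite neq_ltn li orbT.
    by have -> : (j == l) = false by apply/negbTE; rewrite neq_ltn (ltn_trans li ij) orbT.
  by rewrite !mnmDE !mulmnE !mnm1E eqxx eq_sym nij; lia.
rewrite -{2}(submK ak); apply: eq_bigr => z _; congr (_ * _).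
rewrite !mpolyXD -!mpolyXn !rmorphM !rmorphXn /= !mevalXU.
by rewrite !expf_card.
Qed.

(** The multiple of [g] with leading monomial [k] vanishes on [Z]. The hypothesis on smaller
    monomials removes its other terms and leaves a nonzero multiple of [Lambda 'X_[k]]. *)
Lemma leading_step (g : poly) (k : 'X_{1..m.+1}) :
  g != 0 -> (mlead g <= k)%MM -> (forall z, z \in Z -> g.@[z] = 0) ->
  (forall l, l \in msupp g -> mdeg l = mdeg (mlead g)) ->
  (forall k', mdeg k' = mdeg k -> (k' < k)%O -> Lambda 'X_[k'] = 0) ->
  Lambda 'X_[k] = 0.
Proof.
move=> g0 gk gZ gd IH.
have : Lambda ('X_[k - mlead g] * g) = 0.
  by rewrite /Lambda big1 // => z zZ; rewrite mevalM gZ // !mulr0.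
rewrite {2}[g]mpolyE big_distrr /=.
under eq_bigr do rewrite -scalerAr -mpolyXD.
rewrite Lambda_sum (bigD1_seq (mlead g)) ?msupp_uniq ?mlead_supp //= submK //.
rewrite big_seq_cond big1 ?addr0; last first.
  move=> l /andP[lg ll].
  have ld : mdeg (k - mlead g + l) = mdeg k by rewrite -{2}(submK gk) !mdegD (gd l).
  have lk : ((k - mlead g + l)%MM < k)%O.
    by rewrite -{2}(submK gk) ltmc_add2r Order.POrderTheory.lt_neqAle ll msupp_le_mlead.
  by rewrite (IH _ ld lk) mulr0.
by move/eqP; rewrite mulf_eq0 mleadc_eq0 (negbTE g0) /= => /eqP.
Qed.

End Functional.

Section Systems.
Variables (d r : nat) (G : 'I_r -> poly).
Hypothesis dq : (d < q)%N.
Hypothesis G_homog : forall i, homog_deg d (G i).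
Hypothesis G_indep : lin_indep G.

Definition combination (c : {ffun 'I_r -> F}) : poly := \sum_(i < r) c i *: G i.

Definition leading_monomials : {set mono m d} :=
  [set s | [exists c, (combination c != 0) && (mlead (combination c) == mnm_of s)]].

Lemma combination_deg c k : k \in msupp (combination c) -> mdeg k = d.
Proof.
rewrite mcoeff_msupp raddf_sum /= => h.
have [i hi] : exists i, (G i)@_k != 0.
  apply/existsP; rewrite -negb_forall; apply: contra h => /forallP h.
  by rewrite big1 // => i _; rewrite mcoeffZ (eqP (h i)) mulr0.
by apply/eqP; move/allP: (G_homog i); apply; rewrite mcoeff_msupp.
Qed.

Lemma leading_monomials_sub : leading_monomials \subset Mbar q m d.
Proof.
apply/subsetP => s; rewrite inE => /existsP[c /andP[c0 /eqP cs]].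
have q0 : (0 < q)%N by lia.
rewrite Mbar_small //; last exact: ltnW.
rewrite mem_lexmon size_exps eqxx sumn_exps -mdeg_mnm_of -cs.
by apply/eqP/combination_deg; exact: mlead_supp.
Qed.

(** With fewer than [r] leading monomials, a nonzero combination would have coefficient 0 at all of
    them, its own included. *)
Lemma card_leading_monomials : (r <= #|leading_monomials|)%N.
Proof.
rewrite leqNgt; apply/negP => lt.
have := @exists_left_kernel F _ _ [set: 'I_r] leading_monomials
  (fun i s => (G i)@_(mnm_of s)).
rewrite cardsT card_ord => /(_ lt)[c [[i _ ci] h]].
pose c' : {ffun 'I_r -> F} := [ffun i => c i].
have g0 : combination c' != 0.
  by apply: contra ci => /eqP/G_indep/(_ i); rewrite ffunE => ->.
have [s sE] := mnm_of_surj (combination_deg (mlead_supp g0)).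
have sL : s \in leading_monomials by rewrite inE; apply/existsP; exists c'; rewrite g0 sE eqxx.
have := mlead_supp g0; rewrite mcoeff_msupp -sE raddf_sum /= => /eqP; apply.
rewrite -[RHS](h s sL) [RHS](eq_bigl predT) /=; last by move=> j; rewrite inE.
by apply: eq_bigr => j _; rewrite mcoeffZ ffunE.
Qed.

Lemma footprint_bound e : (m.+1 * q < e)%N ->
  (num_common_zeros G <= #|Delta q e leading_monomials|)%N.
Proof.
move=> le; rewrite /num_common_zeros leqNgt; apply/negP => lt.
set Z := [set x | _] in (lt).
(* More zeros than monomials in [Delta] leave a functional that kills these monomials but has a
   nonzero coefficient at some zero [z]. *)
have [c [[z zZ cz] h]] := exists_left_kernel
  (fun (z : point) (a : mono m e) => ('X_[mnm_of a] : poly).@[z]) lt.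
have gZ b x : x \in Z -> (combination b).@[x] = 0.
  rewrite inE => /andP[_ /forallP Gx]; rewrite raddf_sum big1 //= => i _.
  by rewrite mevalZ (eqP (Gx i)) mulr0.
have vanish k : mdeg k = e -> Lambda Z c 'X_[k] = 0.
  elim/(@ltmwf m.+1): k => k IH ke.
  case: (boolP (proj_reduced q (fun i => k i))) => [kr|]; last first.
    case/(reduction_step Z c) => k' [k'd k'k <-].
    by apply: IH => //; rewrite k'd.
  have [a ak] := mnm_of_surj ke.
  have aM : a \in Mbar q m e.
    rewrite inE -mdeg_mnm_of ak ke eqxx /=; move: kr; rewrite -ak.
    by congr is_true; rewrite /proj_reduced; do 2!apply: eq_forallb => ?; rewrite !mnmE.
  case: (boolP (a \in nabla q e leading_monomials)) => aN; last first.
    by rewrite -ak; apply: h; rewrite inE aN.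
  move: aN; rewrite inE aM => /existsP[s /andP[]].
  rewrite inE => /existsP[b /andP[b0 /eqP bs]] /forallP sa.
  apply: (@leading_step Z c (combination b)) => //.
  - by rewrite bs -ak; apply/mnm_lepP => i; rewrite !mnmE.
  - by move=> x; exact: gZ.
  - by move=> l /combination_deg ->; rewrite (combination_deg (mlead_supp b0)).
  - by move=> k' k'd k'k; apply: IH; rewrite // k'd.
have zp : proj_point z by move: zZ; rewrite inE => /andP[].
have /existsP[i /andP[/eqP zi /forallP zlt]] := zp.
have le' : (m.+1 * q.-1 < e)%N.
  by apply: leq_ltn_trans le; rewrite leq_mul2l leq_pred orbT.
(* The form isolating [z] has degree [e], so the functional kills it, yet its value there is
   [c z]. *)
have := Lambda_homog vanish (indicator_form_homog z i (ltnW le')).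
rewrite /Lambda (bigD1 z) //= big1 => [|x /andP[xZ xz]].
  rewrite (indicator_formP le' zi) ?eqxx ?mulr1 ?addr0 => [/eqP||//]; first exact/negP.
  by move=> j ji; apply/eqP; have /implyP := zlt j; exact.
rewrite (indicator_formP le' zi) ?(negbTE xz) ?mulr0 //.
  by move=> j ji; apply/eqP; have /implyP := zlt j; exact.
by move: xZ; rewrite inE => /andP[].
Qed.

End Systems.
End Footprint.

(** * Selection of [r] leading monomials and conclusion *)

Lemma Delta_antitone q m d e (S T : {set mono m d}) : S \subset T ->
  (#|Delta q e T| <= #|Delta q e S|)%N.
Proof.
move=> /subsetP ST; apply: subset_leq_card; apply: setDS.
apply/subsetP => a; rewrite !inE => /andP[-> /existsP[b /andP[bS ba]]].
by apply/existsP; exists b; rewrite ST.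
Qed.

Lemma exists_subset_card (T : finType) (A : {set T}) r : (r <= #|A|)%N ->
  exists2 B : {set T}, B \subset A & #|B| = r.
Proof.
move=> /card_geqP[s [us <- sA]]; exists [set x in s].
  by apply/subsetP => x; rewrite inE => /sA.
by rewrite cardsE; apply/card_uniqP.
Qed.

Local Close Scope ring_scope.

(** Since [d < q], one has [r_d = 0], and the bound on [r] reads ['C(m + d, d)]. *)
Theorem theorem5p7 (F : finFieldType) (m d r : nat) :
  let q := #|F| in
  (0 < m)%N -> (1 <= d)%N -> (d < q)%N ->
  (1 <= r)%N -> (r <= 'C(m + d, d))%N ->
  exists e0 : nat, forall e : nat, (e0 <= e)%N ->
    [/\ (forall S : {set mono m d}, S \subset Mbar q m d -> #|S| = r ->
           (#|Delta q e S| <= #|Delta q e (Mfirst q m d r)|)%N),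
        A_r q m d e r = #|Delta q e (Mfirst q m d r)| &
        (forall G : 'I_r -> {mpoly F[m.+1]},
           (forall i, homog_deg d (G i) && poly_proj_reduced q (G i)) ->
           lin_indep G ->
           (num_common_zeros G <= #|Delta q e (Mfirst q m d r)|)%N)].
Proof.
move=> q _ _ dq _ rC.
have q0 : (0 < q)%N by exact: leq_ltn_trans dq.
have max e (S : {set mono m d}) : (m.+1 * q < e)%N -> S \subset Mbar q m d -> #|S| = r ->
    (#|Delta q e S| <= #|Delta q e (Mfirst q m d r)|)%N.
  by move=> le SM <-; exact: Delta_Mfirst_max.
(* Above this degree [redmon] lists the reduced monomials, whatever [d] and [r]. *)
exists (m.+1 * q).+1 => e le; split; first by move=> S; exact: max.
- apply/eqP; rewrite eqn_leq; apply/andP; split.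
    by apply/bigmax_leqP => S /andP[SM /eqP Sr]; exact: max.
  apply: leq_bigmax_cond; rewrite Mfirst_sub card_Mfirst ?eqxx //; exact: ltnW.
- move=> G hG indep.
  have G_homog i : homog_deg d (G i) by case/andP: (hG i).
  apply: leq_trans (footprint_bound G_homog le) _.
  (* Keeping exactly [r] of the leading monomials can only enlarge [Delta]. *)
  have [S SL Sr] := exists_subset_card (card_leading_monomials G_homog indep).
  apply: leq_trans (Delta_antitone _ _ SL) _.
  by apply: max => //; exact: subset_trans SL (leading_monomials_sub dq G_homog).
Qed.
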